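(* Let $N\ge 2$. For every constant $C_0>0$ there exist constants $C,c>0$, depending only on $N$ and $C_0$, such that the following holds. Let $\mathcal{X}\in\mathbb{R}^{I_1\times\cdots\times I_N}$ be a tensor, let $\mathcal{G}_k\in\mathbb{R}^{R_k\times I_k\times R_{k+1}}$ ($k=1,\dots,N$, $R_{N+1}=R_1$) be TR-cores, and fix $n\in\{1,\dots,N\}$ with $R_nR_{n+1}\ge2$. Let $\mathbf{G}^{\neq n}_{[2]}$ be the mode-2 unfolding, of size $\prod_{j\ne n}I_j\times R_nR_{n+1}$, of the subchain tensor $\mathcal{G}^{\neq n}$, and let $\mathbf{X}_{[n]}\in\mathbb{R}^{I_n\times\prod_{j\ne n}I_j}$ be the mode-$n$ unfolding of $\mathcal{X}$. Let $\varepsilon\in(0,1)$ be such that $\prod_{j\ne n}I_j\le C_0/\varepsilon^{R_nR_{n+1}}$, and let $\eta\in(0,1)$. Let $\mathbf{\Psi}_n\in\mathbb{C}^{m\times\prod_{j\neq n}I_j}$ be a KSRFT with $m$ rows acting on the modes $j\ne n$, and let $$\tilde{\mathbf{G}}_{n(2)}=\arg\min_{\mathbf{G}_{n(2)}\in\mathbb{R}^{I_n\times R_nR_{n+1}}}\left\|\mathbf{X}_{[n]}\mathbf{\Psi}_n^{\top}-\mathbf{G}_{n(2)}\left(\mathbf{\Psi}_n\mathbf{G}^{\neq n}_{[2]}\right)^{\top}\right\|_F .$$ Put $$x=\varepsilon^{-1}(R_nR_{n+1})\log^{2N-3}\left(\left(\frac{R_nR_{n+1}}{\varepsilon}\right)^{\frac{R_nR_{n+1}}{2}}\frac{N-1}{\eta}\right),$$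 $$y=\log^4\left(\left(\frac{R_nR_{n+1}}{\varepsilon}\right)^{\frac12}\log^{N-1}\left(\left(\frac{R_nR_{n+1}}{\varepsilon}\right)^{\frac{R_nR_{n+1}}{2}}\frac{N-1}{\eta}\right)\right)\log\prod_{j\ne n}I_j .$$ (1) If $m\ge C\,xy$, then with probability at least $1-\eta-2^{-c\log\prod_{j\ne n}I_j}$, $$\left\|\mathbf{X}_{[n]}-\tilde{\mathbf{G}}_{n(2)}\left(\mathbf{G}^{\neq n}_{[2]}\right)^{\top}\right\|_F\le(1+\varepsilon)\min_{\mathbf{G}_{n(2)}\in\mathbb{R}^{I_n\times R_nR_{n+1}}}\left\|\mathbf{X}_{[n]}-\mathbf{G}_{n(2)}\left(\mathbf{G}^{\neq n}_{[2]}\right)^{\top}\right\|_F .$$ (2) If in addition $(N-1)/\eta\le(R_nR_{n+1}/\varepsilon)^{R_nR_{n+1}/2}$, then the same conclusion holds, with the same probability, when the condition $m\ge C\,xy$ is replaced by $$m\ge C\,\varepsilon^{-1}(R_nR_{n+1})^{2(N-1)}\log^{2N-3}\left(\frac{R_nR_{n+1}}{\varepsilon}\right)\log^4\left(\frac{R_nR_{n+1}}{\varepsilon}\log\left(\frac{R_nR_{n+1}}{\varepsilon}\right)\right)\log\prod_{j\ne n}I_j .$$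
   Context: Index convention: for $i_k\in\{1,\dots,I_k\}$, $\overline{i_1i_2\cdots i_N}=1+\sum_{k=1}^N(i_k-1)\prod_{j=1}^{k-1}I_j$ (first index varies fastest), and similarly for any other ordered list of indices. $\log^a(z)$ means $(\log z)^a$. Unfoldings: the mode-$n$ unfolding of $\mathcal{X}\in\mathbb{R}^{I_1\times\cdots\times I_N}$ is the $I_n\times\prod_{j\ne n}I_j$ matrix with $\mathbf{X}_{[n]}(i_n,\overline{i_{n+1}\cdots i_Ni_1\cdots i_{n-1}})=\mathcal{X}(i_1,\dots,i_N)$. The classical mode-$n$ unfolding is $\mathbf{X}_{(n)}(i_n,\overline{i_1\cdots i_{n-1}i_{n+1}\cdots i_N})=\mathcal{X}(i_1,\dots,i_N)$; $\mathbf{G}_{n(2)}\in\mathbb{R}^{I_n\times R_nR_{n+1}}$ denotes the classical mode-2 unfolding of a core $\mathcal{G}_n\in\mathbb{R}^{R_n\times I_n\times R_{n+1}}$ (so minimizing over $\mathcal{G}_n$ is the same as minimizing over all real $I_n\times R_nR_{n+1}$ matrices). TR-cores and subchain tensor: write $\mathbf{G}_k(i_k)=\mathcal{G}_k(:,i_k,:)\in\mathbb{R}^{R_k\times R_{k+1}}$ for the lateral slices, with $R_{N+1}=R_1$. The subchain tensor $\mathcal{G}^{\neq n}\in\mathbb{R}^{R_{n+1}\times\prod_{j\ne n}I_j\times R_n}$ is defined by its lateral slices $$\mathbf{G}^{\neq n}(\overline{i_{n+1}\cdots i_Ni_1\cdots i_{n-1}})=\mathbf{G}_{n+1}(i_{n+1})\cdots\mathbf{G}_N(i_N)\,\mathbf{G}_1(i_1)\cdots\mathbf{G}_{n-1}(i_{n-1}),$$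 and $\mathbf{G}^{\neq n}_{[2]}$ is its mode-2 unfolding. KSRFT (Kronecker sub-sampled randomized Fourier transform) on the modes $j\neq n$: $$\mathbf{\Psi}_n=\sqrt{\frac{\prod_{j\ne n}I_j}{m}}\ \mathbf{S}\,\Big((\mathbf{F}_{n-1}\mathbf{D}_{n-1})\otimes\cdots\otimes(\mathbf{F}_1\mathbf{D}_1)\otimes(\mathbf{F}_N\mathbf{D}_N)\otimes\cdots\otimes(\mathbf{F}_{n+1}\mathbf{D}_{n+1})\Big),$$ where $\otimes$ is the Kronecker product (ordered to match the row index of $\mathbf{G}^{\neq n}_{[2]}$); $\mathbf{S}\in\mathbb{R}^{m\times\prod_{j\ne n}I_j}$ consists of $m$ rows drawn uniformly with replacement from the identity matrix of size $\prod_{j\ne n}I_j$; $\mathbf{F}_j\in\mathbb{C}^{I_j\times I_j}$ is the unitary discrete Fourier transform matrix; $\mathbf{D}_j\in\mathbb{R}^{I_j\times I_j}$ is diagonal with independent diagonal entries uniform on $\{+1,-1\}$; all random choices are independent. Probability is over the choice of $\mathbf{S}$ and the $\mathbf{D}_j$. *)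

(* Defs.v *)
From HB Require Import structures.
From mathcomp Require Import all_boot all_order all_algebra.
From mathcomp Require Import all_classical all_reals all_analysis.
From mathcomp Require Export complex mxtens.

Set Implicit Arguments.
Unset Strict Implicit.
Unset Printing Implicit Defensive.

Import Order.TTheory GRing.Theory Num.Theory.
Local Open Scope ring_scope.

(* Modes and indices are 0-based: modes are elements of 'I_N, and ordS is the
   cyclic successor on modes, so that the convention R_{N+1} = R_1 is built
   into the type of the cores. *)

Section Indices.
Variables (N : nat) (I : 'I_N -> nat).

Definition shift (a : 'I_N) (k : nat) : 'I_N := iter k (@ordS N) a.

(* Multi-indices (i_1, ..., i_N). *)
Definition midx := {dffun forall j : 'I_N, 'I_(I j)}.

(* I_a * I_{a+1} * ... * I_{a+k-1}, modes taken cyclically. *)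
Fixpoint cdim (a : 'I_N) (k : nat) : nat :=
  if k is k'.+1 then (I (shift a k') * cdim a k')%N else 1%N.

(* The linear index of (i_a, i_{a+1}, ..., i_{a+k-1}), first index fastest:
   mxtens_index (i, j) has value i * (range of j) + j; see val_linidx. *)
Fixpoint linidx (a : 'I_N) (k : nat) (t : midx) : 'I_(cdim a k) :=
  match k return 'I_(cdim a k) with
  | 0 => ord0
  | k'.+1 => mxtens_index (t (shift a k'), linidx a k' t)
  end.

(* The modes n+1, ..., N, 1, ..., n-1 in this order are
   shift (ordS n) k for k < N - 1. *)
Definition cdim_neq (n : 'I_N) : nat := cdim (ordS n) N.-1.
Definition linidx_neq (n : 'I_N) (t : midx) : 'I_(cdim_neq n) :=
  linidx (ordS n) N.-1 t.

Lemma cdim_prod a k : cdim a k = (\prod_(p < k) I (shift a p))%N.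
Proof.
by elim: k => [|k IH] /=; rewrite ?big_ord0 // big_ord_recr /= IH mulnC.
Qed.

Lemma val_linidx a k t :
  linidx a k t =
  (\sum_(p < k) t (shift a p) * \prod_(q < p) I (shift a q))%N :> nat.
Proof.
elim: k => [|k IH] /=; first by rewrite big_ord0.
by rewrite big_ord_recr /= IH cdim_prod addnC.
Qed.

End Indices.

Section Cyclic.
Variable N : nat.
Implicit Types n a : 'I_N.

Lemma val_shift a k : shift a k = ((a + k) %% N)%N :> nat.
Proof.
elim: k => [|k IH] /=; first by rewrite addn0 modn_small.
by rewrite IH -addn1 modnDml addn1 addnS.
Qed.

Lemma shift_neq_last n : shift (ordS n) N.-1 = n.
Proof.
have N0 : (0 < N)%N by case: n => m; case: N.
apply/ord_inj; rewrite val_shift /= modnDml addSn -addnS prednK //.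
by rewrite modnDr modn_small.
Qed.

Lemma shift_neqE n j : (j != n) = [exists k : 'I_N.-1, shift (ordS n) k == j].
Proof.
have N0 : (0 < N)%N by case: n => m; case: N.
have h k : shift (ordS n) k = ((n + k.+1) %% N)%N :> nat.
  by rewrite val_shift /= modnDml addSnnS.
apply/idP/existsP => [jn|[k /eqP <-]]; last first.
  apply/eqP => /(congr1 (@nat_of_ord N)); rewrite h => E.
  have : (n + k.+1 == n + 0 %[mod N])%N by rewrite E addn0 modn_small.
  rewrite eqn_modDl mod0n modn_small //.
  by have := ltn_ord k; rewrite -ltnS prednK.
pose k0 := ((j + (N - n.+1)) %% N)%N.
have k0N : (k0 < N)%N by rewrite ltn_mod.
have Ek : ((n + k0.+1) %% N = j)%N.
  rewrite addnS -addSn /k0 modnDmr addnCA subnKC // modnDr modn_small //.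
suff k0N1 : (k0 < N.-1)%N by exists (Ordinal k0N1); apply/eqP/ord_inj; rewrite h.
rewrite ltn_neqAle -ltnS prednK // k0N andbT.
apply: contra jn => /eqP E; apply/eqP/ord_inj; rewrite -Ek E prednK //.
by rewrite modnDr modn_small.
Qed.

Lemma shift_neq_inj n : injective (fun k : 'I_N.-1 => shift (ordS n) k).
Proof.
have N0 : (0 < N)%N by case: n => m; case: N.
move=> k l /(congr1 (@nat_of_ord N)) /eqP; rewrite !val_shift eqn_modDl.
rewrite !modn_small; try by rewrite (leq_trans (ltn_ord _)) // leq_pred.
by move=> /eqP /val_inj.
Qed.

Lemma cdim_neqE (I : 'I_N -> nat) n :
  cdim_neq I n = (\prod_(j < N | j != n) I j)%N.
Proof.
rewrite /cdim_neq cdim_prod -(big_imset I (h := fun k : 'I_N.-1 => shift (ordS n) k)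
  (A := predT)) /=; last by move=> k l _ _; apply: shift_neq_inj.
apply: eq_bigl => j; rewrite shift_neqE.
apply/imsetP/existsP => [[k _ ->]|[k /eqP <-]]; first by exists k.
by exists k.
Qed.

End Cyclic.

Section Tensors.
Variable R : realType.

Definition tensor (N : nat) (I : 'I_N -> nat) := midx I -> R.
Definition tensor3 (a b c : nat) := 'I_a -> 'I_b -> 'I_c -> R.

Definition lateral a b c (T : tensor3 a b c) (i : 'I_b) : 'M[R]_(a, c) :=
  \matrix_(x, y) T x i y.

(* T_[2](i, \overline{y x}) = T(x, i, y): the third index is the fastest. *)
Definition unfold2 a b c (T : tensor3 a b c) : 'M[R]_(b, a * c) :=
  \matrix_(i, k) T (mxtens_unindex k).1 i (mxtens_unindex k).2.

(* Exactly one multi-index contributes to each entry; see unfold_modeE. *)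
Definition unfold_mode N (I : 'I_N -> nat) (n : 'I_N) (X : tensor I) :
    'M[R]_(I n, cdim_neq I n) :=
  \matrix_(i, c) \sum_(t : midx I | (t n == i) && (linidx_neq n t == c)) X t.

Lemma unfold_modeE N (I : 'I_N -> nat) (n : 'I_N) (X : tensor I) (t : midx I) :
  unfold_mode n X (t n) (linidx_neq n t) = X t.
Proof.
rewrite mxE (big_pred1 t) // => u; apply/andP/eqP => [[/eqP un /eqP ul]|->//].
apply/ffunP => j.
have [->//|] := eqVneq j n; rewrite shift_neqE => /existsP [k /eqP <-].
suff H m : linidx (ordS n) m u = linidx (ordS n) m t -> forall p, (p < m)%N ->
    u (shift (ordS n) p) = t (shift (ordS n) p) by exact: (H N.-1).
elim: m => [//|m IH] /= /(can_inj (@mxtens_indexK _ _)) [E1 E2] p.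
by rewrite ltnS leq_eqVlt => /orP [/eqP ->//|]; apply: IH.
Qed.

Section Subchain.
Variables (N : nat) (I r : 'I_N -> nat).
Variable G : forall k : 'I_N, tensor3 (r k) (I k) (r (ordS k)).

(* G_a(i_a) G_{a+1}(i_{a+1}) ... G_{a+k-1}(i_{a+k-1}) as a function of the
   linear index of (i_a, ..., i_{a+k-1}); see chain_linidx. *)
Fixpoint chain (a : 'I_N) (k : nat) :
    'I_(cdim I a k) -> 'M[R]_(r a, r (shift a k)) :=
  match k return 'I_(cdim I a k) -> 'M[R]_(r a, r (shift a k)) with
  | 0 => fun _ => 1%:M
  | k'.+1 => fun c => chain (mxtens_unindex c).2 *m
                      lateral (@G (shift a k')) (mxtens_unindex c).1
  end.

Lemma chain_linidx a k (t : midx I) :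
  chain (linidx a k.+1 t) =
  chain (linidx a k t) *m lateral (@G (shift a k)) (t (shift a k)).
Proof.
exact: (congr1 (fun p => chain p.2 *m lateral (@G (shift a k)) p.1)
               (mxtens_indexK (t (shift a k), linidx a k t))).
Qed.

Definition subchain (n : 'I_N) : tensor3 (r (ordS n)) (cdim_neq I n) (r n) :=
  fun x c y =>
    castmx (erefl _, congr1 r (shift_neq_last n)) (chain c) x y.

End Subchain.

Arguments chain {N I r} G {a k} _.
Arguments subchain {N I r} G n _ _ _.

Definition frob p q (A : 'M[R]_(p, q)) : R :=
  Num.sqrt (\sum_i \sum_j A i j ^+ 2).

Definition frobC p q (A : 'M[R[i]]_(p, q)) : R :=
  Num.sqrt (\sum_i \sum_j Normc.normc (A i j) ^+ 2).

Definition complexmx p q (A : 'M[R]_(p, q)) : 'M[R[i]]_(p, q) :=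
  map_mx (real_complex R) A.

(* Unitary discrete Fourier transform: entries exp(- 2 pi i k l / p) / sqrt p. *)
Definition dft (p : nat) : 'M[R[i]]_p :=
  \matrix_(k, l)
    (let theta := 2 * pi * (k * l)%:R / p%:R in
     Complex (cos theta / Num.sqrt p%:R) (- (sin theta / Num.sqrt p%:R))).

Section KSRFT.
Variables (N : nat) (I : 'I_N -> nat) (n : 'I_N) (m : nat).

(* One fair bit for each diagonal entry of each D_j with j != n. *)
Definition signs := {ffun {x : {j : 'I_N & 'I_(I j)} | tag x != n} -> bool}.

(* The m row indices, drawn independently with replacement. *)
Definition rows := {ffun 'I_m -> 'I_(cdim_neq I n)}.

(* D_j for j != n; the branch None is reached only for j = n, which plays no
   role in ksrft. *)
Definition sign_diag (d : signs) (j : 'I_N) : 'M[R]_(I j) :=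
  diag_mx (\row_i (if insub (Tagged (fun j => 'I_(I j)) i) is Some u
                   then (-1) ^+ d u else 1)).

(* A_{a+k-1} (x) ... (x) A_{a+1} (x) A_a. *)
Fixpoint kron (A : forall j : 'I_N, 'M[R[i]]_(I j)) (a : 'I_N) (k : nat) :
    'M[R[i]]_(cdim I a k) :=
  match k return 'M[R[i]]_(cdim I a k) with
  | 0 => 1%:M
  | k'.+1 => A (shift a k') *t kron A a k'
  end.

Definition ksrft (w : rows * signs) : 'M[R[i]]_(m, cdim_neq I n) :=
  (real_complex R (Num.sqrt ((\prod_(j < N | j != n) I j)%N%:R / m%:R))) *:
  (complexmx (rowsub w.1 1%:M) *m
   kron (fun j => dft (I j) *m complexmx (sign_diag w.2 j)) (ordS n) N.-1).

End KSRFT.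

(* Probability of an event under the uniform law on a finite type.  On a product
   such as rows * signs this law makes all the coordinates independent and
   uniform. *)
Definition unif_prob (T : finType) (E : T -> Prop) : R :=
  #|[pred w : T | `[< E w >]]|%:R / #|T|%:R.

Definition is_argmin (T : Type) (f : T -> R) (x : T) : Prop :=
  forall y, f x <= f y.

(* The infimum is attained for the least-squares objectives used here. *)
Definition min_value (T : Type) (f : T -> R) : R := inf (range f).

Section Regression.
Variables (N : nat) (I r : 'I_N -> nat).
Variable X : tensor I.
Variable G : forall k : 'I_N, tensor3 (r k) (I k) (r (ordS k)).
Variable n : 'I_N.

(* The columns of the unknown G_n(2) are indexed by \overline{r_n r_{n+1}} with
   r_n fastest, matching the columns of the mode-2 unfolding of subchain. *)
Definition residual (Gn : 'M[R]_(I n, r (ordS n) * r n)) : R :=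
  frob (unfold_mode n X - Gn *m (unfold2 (subchain G n))^T).

Definition sketched_residual (m : nat) (Psi : 'M[R[i]]_(m, cdim_neq I n))
    (Gn : 'M[R]_(I n, r (ordS n) * r n)) : R :=
  frobC (complexmx (unfold_mode n X) *m Psi^T -
         complexmx Gn *m (Psi *m complexmx (unfold2 (subchain G n)))^T).

(* argmin need not be a singleton: every minimizer of the sketched problem has
   to be near-optimal. *)
Definition sketch_succeeds (eps : R) (m : nat) (w : rows I n m * signs I n) : Prop :=
  forall Gt, is_argmin (sketched_residual (ksrft w)) Gt ->
    residual Gt <= (1 + eps) * min_value residual.

End Regression.

End Tensors.

Arguments chain {R N I r} G {a k} _.
Arguments subchain {R N I r} G n _ _ _.
Arguments residual {R N I r} X G n Gn.
Arguments sketched_residual {R N I r} X G n {m} Psi Gn.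
Arguments sketch_succeeds {R N I r} X G n eps m w.

(* Main.v *)
(** Row norms.  A row of the sketched design is a Rademacher chaos of order N - 1 with
    values in a Euclidean space, because all Fourier entries have modulus P ^ (- 1/2).
    Peeling off one mode at a time with a vector-valued Khintchine inequality bounds its
    p-th moment; with p of the order of ln P, all P rows of the transformed orthonormal
    basis U and of the transformed residual W are flat, except with probability a power
    of 1/P.

    Sampling.  Given flat rows, only two facts about the sampled rows are needed.  The
    first is the lower bound |Psi U x|^2 >= |x|^2 / 16: a one-sided Chernoff bound at every
    point of a grid of mesh 1/M, where M can be taken polynomial in the row norms since
    these bound the quadratic form from above deterministically; the logarithm of M is
    absorbed by the fourth power of a logarithm in the sample size.  The second is that
    the sampled cross term of U and W is small: a moment version of Bernstein's inequality
    in Euclidean space, obtained by adding the summands one at a time.  Comparing the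
    sketched minimizer with the true one then gives |W|^2 + |E|^2 <= (1 + eps) |W|^2.

    The failure probability obtained is 1/P, so eta only enters through the sample size,
    except in part (1) when ln z < ln 4: the logarithm in y may then vanish, but eta >= 1/2
    and P <= 16 C0, so that a small c makes the claim trivial. *)
Require Import Defs.
From mathcomp Require Import all_boot all_order all_algebra.
From mathcomp Require Import all_classical all_reals all_analysis.
From mathcomp Require Import ring lra.
Set Implicit Arguments.
Unset Strict Implicit.
Unset Printing Implicit Defensive.
Import Order.TTheory GRing.Theory Num.Theory.
Local Open Scope ring_scope.

(** * Averages over finite types *)

Section Average.
Variable R : realType.

Definition avg (T : finType) (F : T -> R) : R := (\sum_x F x) / #|T|%:R.

Lemma eq_avg (T : finType) (F G : T -> R) : F =1 G -> avg F = avg G.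
Proof. by move=> FG; rewrite /avg; congr (_ / _); apply: eq_bigr. Qed.

Lemma ler_avg (T : finType) (F G : T -> R) :
  (forall x, F x <= G x) -> avg F <= avg G.
Proof.
move=> FG; apply: ler_wpM2r; first by rewrite invr_ge0.
by apply: ler_sum => x _.
Qed.

Lemma avg_ge0 (T : finType) (F : T -> R) : (forall x, 0 <= F x) -> 0 <= avg F.
Proof. by move=> F0; rewrite divr_ge0 // sumr_ge0. Qed.

Lemma avgD (T : finType) (F G : T -> R) :
  avg (fun x => F x + G x) = avg F + avg G.
Proof. by rewrite /avg big_split mulrDl. Qed.

Lemma avgZ (T : finType) (a : R) (F : T -> R) :
  avg (fun x => a * F x) = a * avg F.
Proof. by rewrite /avg -mulr_sumr mulrA. Qed.

Lemma avg_sum (T J : finType) (A : pred J) (F : J -> T -> R) :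
  avg (fun x => \sum_(j | A j) F j x) = \sum_(j | A j) avg (F j).
Proof. by rewrite /avg exchange_big /= mulr_suml. Qed.

Lemma avg_const (T : finType) (c : R) : (0 < #|T|)%N -> avg (fun _ : T => c) = c.
Proof.
move=> T0; rewrite /avg sumr_const -(mulr_natr c) -mulrA divff ?mulr1 //.
by rewrite pnatr_eq0 -lt0n.
Qed.

Lemma avg_const_le (T : finType) (c : R) : 0 <= c -> avg (fun _ : T => c) <= c.
Proof.
move=> c0; have [T0|/avg_const -> //] := posnP #|T|.
by rewrite /avg T0 invr0 mulr0.
Qed.

Lemma avg_bool (F : bool -> R) : avg F = (F true + F false) / 2.
Proof. by rewrite /avg big_bool card_bool. Qed.

Lemma avg_pair (S T : finType) (F : S * T -> R) :
  avg F = avg (fun y => avg (fun x => F (x, y))).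
Proof.
rewrite /avg -mulr_suml exchange_big /= -mulrA -invfM -natrM -card_prod.
by rewrite pair_big /=; congr (_ / _); apply: eq_bigr => -[].
Qed.

Lemma unif_probE (T : finType) (E : T -> Prop) :
  unif_prob R E = avg (fun x => (`[< E x >])%:R).
Proof.
rewrite /unif_prob /avg; congr (_ / _).
by rewrite -sum1_card natr_sum big_mkcond; apply: eq_bigr => x _; rewrite inE; case: asbool.
Qed.

(** Resampling of one coordinate: through [avg_upd] a single sign or a single sampled row is
    averaged out while all the others stay fixed. *)
Definition upd (A B : finType) (f : {ffun A -> B}) (a : A) (b : B) :
    {ffun A -> B} := [ffun x => if x == a then b else f x].

Lemma upd_same (A B : finType) (f : {ffun A -> B}) a b : upd f a b a = b.
Proof. by rewrite ffunE eqxx. Qed.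

Lemma upd_other (A B : finType) (f : {ffun A -> B}) a b x :
  x != a -> upd f a b x = f x.
Proof. by move=> /negPf xa; rewrite ffunE xa. Qed.

Lemma updK (A B : finType) (f : {ffun A -> B}) a b : upd (upd f a b) a (f a) = f.
Proof. by apply/ffunP => x; rewrite !ffunE; case: eqP => // ->. Qed.

(* Swapping the fresh value with the value at [a] is an involution of
   [{ffun A -> B} * B]. *)
Lemma avg_upd (A B : finType) (F : {ffun A -> B} -> R) (a : A) :
  (0 < #|B|)%N -> avg F = avg (fun f => avg (fun b => F (upd f a b))).
Proof.
move=> B0; transitivity (avg (fun p : {ffun A -> B} * B => F p.1)).
  rewrite avg_pair /= avg_const //.
transitivity (avg (fun p : {ffun A -> B} * B => F (upd p.1 a p.2))).
  rewrite /avg; congr (_ / _).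
  pose h (p : {ffun A -> B} * B) := (upd p.1 a p.2, p.1 a).
  have hK : involutive h by case=> f b; rewrite /h /= updK upd_same.
  by rewrite (reindex_inj (inv_inj hK)).
rewrite avg_pair /avg -!mulr_suml exchange_big /=.
by rewrite mulrAC.
Qed.

(** Independence of the coordinates: distributivity expands the m-th power of a sum into a sum over
    all functions from ['I_m]. *)
Lemma avg_prod (m : nat) (T : finType) (g : T -> R) :
  avg (fun f : {ffun 'I_m -> T} => \prod_k g (f k)) = avg g ^+ m.
Proof.
rewrite /avg expr_div_n card_ffun card_ord natrX; congr (_ / _).
by rewrite -(bigA_distr_bigA (fun (_ : 'I_m) x => g x)) /= prodr_const card_ord.
Qed.

(** Markov's inequality for the p-th power. Exceeding the moment bound by a factor 8 costs 8^-p,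
    which is a power of 1/P once p is of the order of ln P. *)
Lemma markov_pow (T : finType) (X : T -> R) (t : R) (p : nat) :
  (0 < p)%N -> 0 <= t -> (forall x, 0 <= X x) ->
  avg (fun x => X x ^+ p) <= t ^+ p ->
  avg (fun x => (8 * t < X x)%R%:R) <= (8 ^+ p)^-1.
Proof.
move=> p0 t0 X0 Xt; have p8 : 0 < 8 ^+ p :> R by rewrite exprn_gt0.
(* For t = 0 the p-th moment vanishes, hence so does X, and the event is empty; otherwise one may
   divide by t^p. *)
move: t0; rewrite le_eqVlt => /orP[/eqP t0|t0].
- have [T0|T0] := posnP #|T|; first by rewrite /avg T0 invr0 mulr0 invr_ge0 ltW.
  move: Xt; rewrite -t0 expr0n gtn_eqF // mulr0 /avg.
  rewrite pmulr_lle0 ?invr_gt0 ?ltr0n // => Xt.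
  rewrite big1 ?mul0r ?invr_ge0 ?(ltW p8) // => x _.
suff : X x ^+ p == 0.
  by rewrite expf_eq0 p0 /= => /eqP ->; rewrite ltxx.
rewrite eq_le exprn_ge0 // andbT.
by apply: le_trans Xt; rewrite (bigD1 x) //= lerDl sumr_ge0 // => y _; rewrite exprn_ge0.
have tp : 0 < t ^+ p by rewrite exprn_gt0.
rewrite -[leRHS]div1r ler_pdivlMr // mulrC -(ler_pM2r tp) mul1r mulrAC -avgZ.
apply: le_trans Xt; apply: ler_avg => x.
case: ltP => [|_]; last by rewrite mulr0 exprn_ge0.
move=> tX; rewrite mulr1 -exprMn.
by apply: lerXn2r; rewrite ?nnegrE ?X0 ?(ltW tX) // mulr_ge0 // ltW.
Qed.

End Average.

(** * Moment and tail bounds *)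

Section Moments.
Variable R : realType.

Definition dot (E : finType) (v w : E -> R) : R := \sum_e v e * w e.
Definition nsq (E : finType) (v : E -> R) : R := \sum_e v e ^+ 2.

Lemma nsq_ge0 (E : finType) (v : E -> R) : 0 <= nsq v.
Proof. by apply: sumr_ge0 => e _; rewrite sqr_ge0. Qed.

Lemma nsqDZ (E : finType) (a : R) (v w : E -> R) :
  nsq (fun e => v e + a * w e) = nsq v + 2 * a * dot v w + a ^+ 2 * nsq w.
Proof.
rewrite /nsq /dot !mulr_sumr -!big_split /=; apply: eq_bigr => e _; ring.
Qed.

Lemma nsq_eq0 (E : finType) (v : E -> R) e : nsq v <= 0 -> v e = 0.
Proof.
rewrite /nsq (bigD1 e) //= => h; apply/eqP; rewrite -sqrf_eq0 eq_le sqr_ge0.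
rewrite andbT; apply: le_trans h; rewrite lerDl sumr_ge0 // => i _.
exact: sqr_ge0.
Qed.

Lemma cauchy_schwarz (E : finType) (v w : E -> R) :
  dot v w ^+ 2 <= nsq v * nsq w.
Proof.
have [w0|w0] := leP (nsq w) 0.
  rewrite /dot big1 ?expr0n ?mulr_ge0 ?nsq_ge0 // => e _.
  by rewrite (nsq_eq0 e w0) mulr0.
have := nsq_ge0 (fun e => v e + - (dot v w / nsq w) * w e).
rewrite nsqDZ => h; rewrite -subr_ge0.
have -> : nsq v * nsq w - dot v w ^+ 2 = nsq w *
  (nsq v + 2 * - (dot v w / nsq w) * dot v w + (- (dot v w / nsq w)) ^+ 2 * nsq w).
  by field; rewrite gt_eqF.
by rewrite mulr_ge0 // ltW.
Qed.

(* With [M k] and [D k] half the sum and half the difference of the [k]-th powers of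
   [Y + B + 2 r] and [Y + B - 2 r], one has [M k.+1 = S M k + d D k] and
   [S d D k <= k d^2 M k] for [S = Y + B], [d = 2 r]. *)
Lemma rademacher_power_step (Y B r : R) (p : nat) :
  0 <= Y -> 0 <= B -> r ^+ 2 <= Y * B ->
  ((Y + B + 2 * r) ^+ p + (Y + B - 2 * r) ^+ p) / 2 <= (Y + 4 * p%:R * B) ^+ p.
Proof.
move=> Y0 B0 rYB; set S := Y + B; set d := 2 * r.
have S0 : 0 <= S by rewrite addr_ge0.
have d4 : d ^+ 2 <= 4 * B * S.
  rewrite /d /S; have := sqr_ge0 B; nra.
have dS : d ^+ 2 <= S ^+ 2 by rewrite /d /S; have := sqr_ge0 (Y - B); nra.
pose M k := ((S + d) ^+ k + (S - d) ^+ k) / 2.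
pose D k := ((S + d) ^+ k - (S - d) ^+ k) / 2.
have MS k : M k.+1 = S * M k + d * D k by rewrite /M /D !exprS; field.
have DS k : D k.+1 = S * D k + d * M k by rewrite /M /D !exprS; field.
have inv k : [/\ 0 <= M k, 0 <= d * D k & S * (d * D k) <= k%:R * d ^+ 2 * M k].
  elim: k => [|k [M0 D0 IH]].
    have -> : M 0%N = 1 by rewrite /M !expr0; lra.
    have -> : D 0%N = 0 by rewrite /D !expr0 subrr mul0r.
    by rewrite !mulr0 !mul0r; split.
  have M1 : 0 <= M k.+1 by rewrite MS addr_ge0 // mulr_ge0.
  have dd : 0 <= d ^+ 2 := sqr_ge0 d.
  have SM : S * M k <= M k.+1 by rewrite MS lerDl.
  split => //.
    rewrite DS mulrDr (mulrCA d S) (mulrA d d); apply: addr_ge0; first by rewrite mulr_ge0.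
    by rewrite -expr2 mulr_ge0.
  rewrite DS -natr1.
  have h : S * (S * (d * D k)) <= S * (k%:R * d ^+ 2 * M k) by rewrite ler_wpM2l.
  have h2 : (k%:R + 1) * d ^+ 2 * (S * M k) <= (k%:R + 1) * d ^+ 2 * M k.+1.
    by rewrite ler_wpM2l // mulr_ge0 // addr_ge0.
  apply: le_trans h2; apply: le_trans (_ : S * (S * (d * D k)) + S * d ^+ 2 * M k <= _).
    by rewrite le_eqVlt; apply/orP; left; apply/eqP; ring.
  by apply: le_trans (lerD h (lexx _)) _; rewrite le_eqVlt; apply/orP; left; apply/eqP; ring.
(* Divide the third invariant by S and use d^2 <= 4 B S. If S = 0, then d = 0 because d^2 <= S^2. *)
have bnd k : d * D k <= 4 * k%:R * B * M k.
  have [M0 D0 h] := inv k; move: S0; rewrite le_eqVlt => /orP[/eqP S0|S0].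
    have d0 : d = 0 by apply/eqP; rewrite -sqrf_eq0 eq_le sqr_ge0 (le_trans dS) // -S0 expr0n.
    by rewrite d0 mul0r mulr_ge0 // mulr_ge0 // mulr_ge0.
  rewrite -(ler_pM2l S0); apply: le_trans h _.
  have : k%:R * M k * d ^+ 2 <= k%:R * M k * (4 * B * S).
    by apply: ler_wpM2l => //; apply: mulr_ge0.
  by congr (_ <= _); ring.
(* Each step multiplies [M k] by at most Y + (1 + 4 k) B, and 1 + 4 k <= 4 p as long as k < p. *)
have main k : (k <= p)%N -> M k <= (Y + 4 * p%:R * B) ^+ k.
  elim: k => [|k IH] kp; first by rewrite /M !expr0; lra.
  have [M0 _ _] := inv k.
  rewrite MS exprS; apply: le_trans (_ : (S + 4 * k%:R * B) * M k <= _).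
    by rewrite [leRHS]mulrDl lerD2l bnd.
  apply: ler_pM => //; [by rewrite addr_ge0 // !mulr_ge0| |exact: IH (ltnW kp)].
  rewrite /S -addrA lerD2l -[X in X + _]mul1r -mulrDl ler_wpM2r //.
  have : k.+1%:R <= p%:R :> R by rewrite ler_nat.
  rewrite -natr1; lra.
exact: main.
Qed.

(** A reverse Bernoulli inequality with explicit second-order remainder. It linearizes a p-th power,
    so that the first-order term can be averaged away in [bernstein_step]. *)
Lemma bernoulli_upper (h : R) (k : nat) :
  k%:R * `|h| <= 1 -> 0 <= 1 + h ->
  (1 + h) ^+ k <= 1 + k%:R * h + (k%:R * h) ^+ 2.
Proof.
move=> + h1; elim: k => [|k IH] kh; first by rewrite expr0; nra.
have k0 : 0 <= k%:R :> R by [].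
have h0 := normr_ge0 h.
have kh' : k%:R * `|h| <= 1 by move: kh; rewrite -natr1; nra.
rewrite exprS; apply: le_trans (ler_wpM2l h1 (IH kh')) _.
rewrite -natr1.
have khl : k%:R * h <= 1 by apply: le_trans kh'; rewrite ler_wpM2l // ler_norm.
(* This is the exact difference of the two sides; it is nonnegative because k h <= 1. *)
have : 0 <= h ^+ 2 * (k%:R * (1 - k%:R * h) + 1).
  by rewrite mulr_ge0 ?sqr_ge0 // addr_ge0 // mulr_ge0 // subr_ge0.
rewrite -subr_ge0; congr (_ <= _); ring.
Qed.

(** The signs are averaged out one at a time, and by [rademacher_power_step] each of them costs an
    additive 4 p |g_j|^2. The coefficients may depend on signs outside the range of [u], as happens
    when one mode of a chaos is peeled off. *)
Lemma khintchine (U J E : finType) (u : J -> U) (g : J -> {ffun U -> bool} -> E -> R)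
    (p : nat) :
  injective u -> (forall j j' d b, g j (upd d (u j') b) = g j d) ->
  avg (fun d : {ffun U -> bool} => nsq (fun e => \sum_j (-1) ^+ d (u j) * g j d e) ^+ p) <=
  avg (fun d => (4 * p%:R * \sum_j nsq (g j d)) ^+ p).
Proof.
move=> uI gu.
(* The additive term [c] collects the contributions of the signs already averaged out; it is free of
   the signs still to come. *)
suff H (l : seq J) (c : {ffun U -> bool} -> R) : uniq l -> (forall d, 0 <= c d) ->
    (forall j d b, c (upd d (u j) b) = c d) ->
    avg (fun d : {ffun U -> bool} =>
      (nsq (fun e => \sum_(j <- l) (-1) ^+ d (u j) * g j d e) + c d) ^+ p)
    <= avg (fun d => (c d + 4 * p%:R * \sum_(j <- l) nsq (g j d)) ^+ p).
  have := H (index_enum J) (fun _ => 0) (index_enum_uniq J) (fun _ => lexx 0)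
    (fun _ _ _ => erefl).
  by under eq_avg do rewrite addr0; under [X in _ <= X]eq_avg do rewrite add0r.
elim: l c => [|j l IH] c /=.
  move=> _ c0 _; apply: ler_avg => d; rewrite big_nil mulr0 addr0.
  suff -> : nsq (fun e => \sum_(j <- [::]) (-1) ^+ d (u j) * g j d e) = 0 by rewrite add0r.
  by rewrite /nsq big1 // => e _; rewrite big_nil expr0n.
move=> /andP[jl ul] c0 cu; rewrite (avg_upd _ (u j)) ?card_bool //.
apply: le_trans (_ : avg (fun d : {ffun U -> bool} =>
    (nsq (fun e => \sum_(j <- l) (-1) ^+ d (u j) * g j d e)
    + (c d + 4 * p%:R * nsq (g j d))) ^+ p) <= _); last first.
  apply: le_trans (IH _ ul _ _) _.
  - by move=> d; rewrite addr_ge0 // mulr_ge0 // nsq_ge0.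
  - by move=> j' d b; rewrite cu gu.
  apply: ler_avg => d; rewrite big_cons mulrDr addrA //.
apply: ler_avg => d; set S := fun e => \sum_(j <- l) _.
have Eb b : nsq (fun e => \sum_(j' <- j :: l)
      (-1) ^+ (upd d (u j) b) (u j') * g j' (upd d (u j) b) e) =
    nsq S + 2 * (-1) ^+ b * dot S (g j d) + nsq (g j d).
  rewrite -[X in _ = _ + X]mul1r -[X in _ = _ + X * _](sqrr_sign _ b) -nsqDZ.
  apply: eq_bigr => e _; rewrite big_cons upd_same gu addrC; congr ((_ + _) ^+ 2).
  apply: eq_big_seq => j' j'l; rewrite gu upd_other //.
  by apply: contra jl => /eqP /uI <-.
rewrite avg_bool !Eb !cu expr1 expr0.
(* Here Y = |S|^2 + c, B = |g_j|^2 and r = S . g_j, so that r^2 <= Y B is Cauchy-Schwarz. *)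
apply: le_trans (le_trans (@rademacher_power_step (nsq S + c d) (nsq (g j d))
   (dot S (g j d)) p _ _ _) _).
- rewrite le_eqVlt; apply/orP; left; apply/eqP; rewrite addrC.
  by congr ((_ ^+ p + _ ^+ p) / 2); ring.
- by rewrite addr_ge0 // nsq_ge0.
- exact: nsq_ge0.
- apply: le_trans (cauchy_schwarz _ _) _.
  by rewrite ler_wpM2r ?nsq_ge0 // lerDl.
- by rewrite addrA.
Qed.

(** Since Y = |S|^2 + c >= 9 p^2 V, the relative change h of Y caused by Z satisfies p |h| <= 1, and
    [bernoulli_upper] applies. As Z is centred, the linear term leaves p |Z|^2 / Y on average; with
    h^2 <= 9 |Z|^2 / Y the total is at most (p + 9 p^2) s2 / Y <= 10 p^2 s2 / Y. *)
Lemma bernstein_step (T E : finType) (Z : T -> E -> R) (V s2 c : R) (p : nat)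
    (S : E -> R) :
  (0 < p)%N -> 0 < c -> 9 * p%:R ^+ 2 * V <= c ->
  (forall e, avg (Z ^~ e) = 0) -> (forall t, nsq (Z t) <= V) ->
  avg (fun t => nsq (Z t)) <= s2 ->
  avg (fun t => (nsq (fun e => S e + 1 * Z t e) + c) ^+ p) <=
  (nsq S + c + 10 * p%:R * s2) ^+ p.
Proof.
move=> p0 c0 cV Z0 ZV Zs; set Y := nsq S + c; set x : R := p%:R.
have x1 : 1 <= x by rewrite ler1n.
have x0 : 0 <= x by lra.
have Y0 : 0 < Y by rewrite ltr_wpDl ?nsq_ge0.
have s0 : 0 <= s2 by apply: le_trans Zs; apply: avg_ge0 => t; exact: nsq_ge0.
pose h t := (2 * dot S (Z t) + nsq (Z t)) / Y.
have step t : (nsq (fun e => S e + 1 * Z t e) + c) ^+ p <=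
    Y ^+ p * (1 + x * h t + 9 * x ^+ 2 * nsq (Z t) / Y).
  have -> : nsq (fun e => S e + 1 * Z t e) + c = Y * (1 + h t).
    by rewrite nsqDZ /h /Y; field; rewrite gt_eqF.
  have z0 := nsq_ge0 (Z t).
  set r := dot S (Z t); set z := nsq (Z t) in z0 *.
  have rz : r ^+ 2 <= Y * z.
    by apply: le_trans (cauchy_schwarz _ _) _; rewrite ler_wpM2r // lerDl ltW.
  have zY : 9 * x ^+ 2 * z <= Y.
    apply: le_trans (le_trans cV _); last by rewrite lerDr nsq_ge0.
    by apply: ler_wpM2l; [rewrite mulr_ge0 ?sqr_ge0|exact: ZV].
  have xr : 3 * x * `|r| <= Y.
    rewrite -(@ler_pXn2r _ 2) ?nnegrE ?(ltW Y0) ?mulr_ge0 ?x0 //.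
    rewrite exprMn real_normK ?num_real //.
    apply: le_trans (_ : 9 * x ^+ 2 * (Y * z) <= _).
      rewrite exprMn; have -> : 3 ^+ 2 = 9 :> R by ring.
      by apply: ler_wpM2l; [rewrite mulr_ge0 ?sqr_ge0|].
    have := ler_wpM2l (ltW Y0) zY; rewrite -expr2; congr (_ <= _); ring.
  have xz : 9 * x * z <= Y.
    have : 0 <= (x - 1) * (x * z) by rewrite !mulr_ge0 // subr_ge0.
    by move: zY; lra.
  have hb : x * `|h t| <= 1.
    rewrite /h -/r -/z normrM normfV (gtr0_norm Y0) mulrA ler_pdivrMr // mul1r.
    have := ler_normD (2 * r) z; rewrite normrM (ger0_norm z0) ger0_norm //.
    nra.
  have h1 : 0 <= 1 + h t.
    have : `|h t| <= 1 by have := normr_ge0 (h t); nra.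
    by rewrite ler_norml; lra.
  rewrite exprMn ler_wpM2l ?exprn_ge0 ?(ltW Y0) //.
  apply: le_trans (bernoulli_upper hb h1) _; rewrite lerD2l.
  have z2 : z ^+ 2 * 9 <= Y * z by rewrite mulrC expr2 mulrA ler_wpM2r //; nra.
  have hz : h t ^+ 2 <= 9 * z / Y.
    rewrite /h -/r -/z expr_div_n ler_pdivrMr ?exprn_gt0 //.
    have -> : 9 * z / Y * Y ^+ 2 = 9 * (z * Y) by field; rewrite gt_eqF.
    by have := sqr_ge0 (2 * r - z); nra.
  rewrite exprMn; have -> : 9 * x ^+ 2 * z / Y = x ^+ 2 * (9 * z / Y) by ring.
  by rewrite ler_wpM2l ?sqr_ge0.
apply: le_trans (ler_avg step) _.
rewrite avgZ.
have dot0 : avg (fun t => dot S (Z t)) = 0.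
  by rewrite avg_sum big1 // => e _; rewrite avgZ Z0 mulr0.
have -> : avg (fun t => 1 + x * h t + 9 * x ^+ 2 * nsq (Z t) / Y) =
   avg (fun _ : T => 1) + (x + 9 * x ^+ 2) / Y * avg (fun t => nsq (Z t)).
  rewrite (@eq_avg _ _ _ (fun t => 1 + (2 * x / Y * dot S (Z t) +
      (x + 9 * x ^+ 2) / Y * nsq (Z t)))); last by move=> t; rewrite /h; ring.
  by rewrite !avgD !avgZ dot0 mulr0 add0r.
(* The ordinary Bernoulli inequality folds the linear bound back into a p-th power. *)
have bern (a : R) k : 0 <= a -> 1 + k%:R * a <= (1 + a) ^+ k.
  move=> a0; elim: k => [|k IH]; first by rewrite mul0r addr0.
  rewrite exprS; apply: le_trans (ler_wpM2l _ IH); last by rewrite addr_ge0.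
  have : 0 <= k%:R * (a * a) by rewrite !mulr_ge0.
  by rewrite -natr1; lra.
have -> : Y + 10 * x * s2 = Y * (1 + 10 * x * s2 / Y).
  by field; rewrite gt_eqF.
rewrite exprMn ler_wpM2l ?exprn_ge0 ?(ltW Y0) //.
apply: le_trans (bern _ _ _); last by rewrite divr_ge0 ?(ltW Y0) // !mulr_ge0 //.
apply: lerD; first by apply: avg_const_le.
have -> : p%:R * (10 * x * s2 / Y) = 10 * x ^+ 2 / Y * s2 by rewrite -/x; ring.
apply: ler_pM => //.
- by rewrite divr_ge0 ?(ltW Y0) // addr_ge0 // ?mulr_ge0 ?sqr_ge0.
- by apply: avg_ge0 => t; exact: nsq_ge0.
- by rewrite ler_pM2r ?invr_gt0 //; nra.
Qed.


(** The sampled rows are averaged out one at a time. Each use of [bernstein_step] replaces the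
    additive term a by a + 10 p s2, starting from a = c, so the condition on V stays true
    throughout. *)
Lemma bernstein (T E : finType) (Z : T -> E -> R) (V s2 c : R) (p m : nat) :
  (0 < #|T|)%N -> (0 < p)%N -> 0 < c -> 9 * p%:R ^+ 2 * V <= c -> 0 <= s2 ->
  (forall e, avg (Z ^~ e) = 0) -> (forall t, nsq (Z t) <= V) ->
  avg (fun t => nsq (Z t)) <= s2 ->
  avg (fun f : {ffun 'I_m -> T} => nsq (fun e => \sum_k Z (f k) e) ^+ p) <=
  (c + 10 * p%:R * m%:R * s2) ^+ p.
Proof.
move=> T0 p0 c0 cV s0 Z0 ZV Zs.
have x0 : 0 <= 10 * p%:R * s2 by rewrite !mulr_ge0.
suff H (l : seq 'I_m) (a : R) : uniq l -> c <= a ->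
    avg (fun f : {ffun 'I_m -> T} => (nsq (fun e => \sum_(k <- l) Z (f k) e) + a) ^+ p)
    <= (a + (size l)%:R * (10 * p%:R * s2)) ^+ p.
  have := H (index_enum 'I_m) c (index_enum_uniq _) (lexx c).
  have -> : size (index_enum 'I_m) = m by rewrite -[RHS]size_enum_ord enumT.
  have -> : m%:R * (10 * p%:R * s2) = 10 * p%:R * m%:R * s2 :> R by ring.
  apply: le_trans.
  apply: ler_avg => f; apply: lerXn2r; rewrite ?nnegrE ?addr_ge0 ?nsq_ge0 ?(ltW c0) //.
  by rewrite lerDl ltW.
elim: l a => [|k l IH] a /= => [_ ca|/andP[kl ul] ca].
  rewrite mul0r addr0.
  have a0 : 0 <= a by rewrite (le_trans (ltW c0)).
  rewrite (@eq_avg _ _ _ (fun => a ^+ p)) ?avg_const_le ?exprn_ge0 // => f.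
  by rewrite /nsq big1 ?add0r // => e _; rewrite big_nil expr0n.
rewrite (avg_upd _ k) //.
have -> : a + (size l).+1%:R * (10 * p%:R * s2) =
    a + 10 * p%:R * s2 + (size l)%:R * (10 * p%:R * s2) by rewrite -natr1; ring.
apply: le_trans (IH _ ul _); last by rewrite (le_trans ca) // lerDl.
apply: ler_avg => f; rewrite addrA.
apply: le_trans (bernstein_step (fun e => \sum_(k0 <- l) Z (f k0) e) p0
  (lt_le_trans c0 ca) (le_trans cV ca) Z0 ZV Zs).
apply: ler_avg => t; rewrite le_eqVlt; apply/orP; left; apply/eqP.
congr ((_ + a) ^+ p); apply: eq_bigr => e _; rewrite big_cons upd_same mul1r addrC.
congr ((_ + _) ^+ 2); apply: eq_big_seq => k' k'l; rewrite upd_other //.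
by apply: contra kl => /eqP <-.
Qed.

(** Multiply by exp y >= 1 + y and use (1 + y) (1 - y + y^2) = 1 + y^3 >= 1. *)
Lemma expRN_upper (y : R) : 0 <= y -> expR (- y) <= 1 - y + y ^+ 2.
Proof.
move=> y0; rewrite expRN -(ler_pM2l (expR_gt0 y)) divff ?gt_eqF ?expR_gt0 //.
apply: le_trans (_ : (1 + y) * (1 - y + y ^+ 2) <= _).
  have -> : (1 + y) * (1 - y + y ^+ 2) = 1 + y ^+ 3 by ring.
  by rewrite lerDl exprn_ge0.
rewrite ler_wpM2r ?expR_ge1Dx //.
have := sqr_ge0 (y - 1 / 2); lra.
Qed.

(** Exponential Markov inequality for the lower tail. If mu = 0 the event is empty, because Y is
    nonnegative. *)
Lemma chernoff_lower (T : finType) (Y : T -> R) (mu K : R) (m : nat) :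
  (0 < #|T|)%N -> 0 < K -> avg Y = mu -> (forall t, 0 <= Y t <= K * mu) ->
  avg (fun f : {ffun 'I_m -> T} => (\sum_k Y (f k) < m%:R * mu / 2)%R%:R) <=
  expR (- (m%:R / (16 * K))).
Proof.
move=> T0 K0 Ymu YK.
have mu0 : 0 <= mu by rewrite -Ymu avg_ge0 // => t; case/andP: (YK t).
move: (mu0); rewrite le_eqVlt => /orP[/eqP mu00|mup].
  rewrite (@eq_avg _ _ _ (fun => 0)) => [|f].
    exact: le_trans (avg_const_le _ (lexx 0)) (expR_ge0 _).
  by rewrite -mu00 mulr0 mul0r ltNge sumr_ge0 // => k _; case/andP: (YK (f k)).
(* With this choice th Y <= 1/4, hence exp(- th Y) <= 1 - (3/4) th Y. The exponent becomes m th mu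
   (1/2 - 3/4) = - m / (16 K). *)
pose th := (4 * K * mu)^-1.
have th0 : 0 < th by rewrite invr_gt0 !mulr_gt0.
apply: le_trans (_ : avg (fun f : {ffun 'I_m -> T} => expR (th * m%:R * mu / 2) *
    \prod_k expR (- (th * Y (f k)))) <= _).
  apply: ler_avg => f; rewrite -expR_sum -expRD.
  case: ltP => [h|_]; last by rewrite expR_ge0.
  rewrite -[leLHS]expR0 ler_expR sumrN -mulr_sumr -mulrA -mulrA -mulrBr mulr_ge0 ?(ltW th0) //.
  by rewrite subr_ge0 mulrA ltW.
rewrite avgZ (avg_prod _ (fun t => expR (- (th * Y t)))).
have s1 : avg (fun t => expR (- (th * Y t))) <= expR (- (3 / 4 * th * mu)).
  apply: le_trans (expR_ge1Dx _).
  apply: le_trans (_ : avg (fun t => 1 + - (3 / 4 * th) * Y t) <= _); last first.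
    by rewrite avgD avgZ Ymu avg_const // mulNr.
  apply: ler_avg => t; have /andP[y0 yK] := YK t.
  apply: le_trans (expRN_upper _) _; first by rewrite mulr_ge0 // ltW.
  have e : th * (K * mu) = 1 / 4 by rewrite /th; field; rewrite !gt_eqF.
  have : th * Y t <= 1 / 4 by rewrite -e ler_pM2l.
  have : 0 <= th * Y t by rewrite mulr_ge0 // ltW.
  nra.
apply: le_trans (ler_wpM2l (expR_ge0 _) (lerXn2r _ _ _ s1)) _.
- by rewrite nnegrE avg_ge0 // => t; exact: expR_ge0.
- by rewrite nnegrE expR_ge0.
rewrite -expRM_natl -expRD ler_expR le_eqVlt; apply/orP; left; apply/eqP.
by rewrite /th; field; rewrite !gt_eqF.
Qed.

End Moments.

(** * Uniform row sampling *)

Section Sampling.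
Variable R : realType.

(** The points of [-1, 1]^rho whose coordinates are multiples of 1/M, so that there are (2 M +
    1)^rho of them. *)
Definition grid_point (rho M : nat) (g : {ffun 'I_rho -> 'I_(2 * M).+1}) (a : 'I_rho) : R :=
  ((g a)%:R - M%:R) / M%:R.

Lemma grid_approx (rho M : nat) (x : 'I_rho -> R) :
  (0 < M)%N -> nsq x = 1 ->
  exists g, nsq (fun a => grid_point (M := M) g a - x a) <= rho%:R / M%:R ^+ 2.
Proof.
move=> M0 x1; have Mp : 0 < M%:R :> R by rewrite ltr0n.
have xb a : -1 <= x a <= 1.
  rewrite -ler_norml -(@ler_pXn2r _ 2) ?nnegrE // real_normK ?num_real // expr1n -x1.
  by rewrite /nsq (bigD1 a) //= lerDl sumr_ge0 // => i _; rewrite sqr_ge0.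
have y0 a : 0 <= (x a + 1) * M%:R.
  by case/andP: (xb a) => l _; rewrite mulr_ge0 //; lra.
(* Each coordinate is rounded down to a multiple of 1/M; [kM] below shows that [inord] does not fall
   back on its default. *)
exists [ffun a => inord (Num.truncn ((x a + 1) * M%:R))].
have -> : rho%:R / M%:R ^+ 2 = \sum_(a < rho) M%:R ^- 2 :> R.
  by rewrite sumr_const card_ord mulr_natl.
apply: ler_sum => a _; rewrite /grid_point ffunE.
have /andP[l h] := xb a.
have /andP[] := truncn_itv (y0 a).
set k := Num.truncn _ => k1 k2.
have kM : (k < (2 * M).+1)%N.
  rewrite ltnS -(ler_nat R); apply: le_trans k1 _; rewrite natrM ler_wpM2r //; lra.
rewrite inordK //.
have -> : (k%:R - M%:R) / M%:R - x a = (k%:R - (x a + 1) * M%:R) / M%:R.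
  by field; rewrite gt_eqF.
rewrite expr_div_n -[leRHS]mul1r ler_wpM2r ?invr_ge0 ?exprn_ge0 ?ltW //.
rewrite -natr1 in k2; nra.
Qed.

(** For a unit vector z and a grid point y with |y - z|^2 = d one has Q y <= 2 Q z + 2 m L d and
    |y|^2 >= 1/2 - d. Together with Q y >= m |y|^2 / 2 this gives Q z >= m/8 - m d (L + 1/4), and
    the condition on M makes the last term at most m/16. *)
Lemma grid_lower_bound (K : finType) (rho M : nat) (v : K -> 'I_rho -> R) (m L : R) :
  (0 < M)%N -> 0 <= m -> 0 <= L -> 16 * rho%:R * (L + 1 / 4) <= M%:R ^+ 2 ->
  \sum_k nsq (v k) <= m * L ->
  (forall g, m * nsq (grid_point (M := M) g) / 2 <=
     \sum_k dot (v k) (grid_point (M := M) g) ^+ 2) ->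
  forall x, m / 16 * nsq x <= \sum_k dot (v k) x ^+ 2.
Proof.
move=> M0 m0 L0 ML vL gridQ x.
pose Q y := \sum_k dot (v k) y ^+ 2.
have Q0 y : 0 <= Q y by apply: sumr_ge0 => k _; rewrite sqr_ge0.
have QL y : Q y <= m * L * nsq y.
  apply: le_trans (_ : \sum_k nsq (v k) * nsq y <= _).
    by apply: ler_sum => k _; exact: cauchy_schwarz.
  by rewrite -mulr_suml ler_wpM2r ?nsq_ge0.
have QD y z : Q y <= 2 * Q z + 2 * Q (fun a => y a - z a).
  rewrite /Q !mulr_sumr -big_split /=; apply: ler_sum => k _.
  have -> : dot (v k) (fun a => y a - z a) = dot (v k) y - dot (v k) z.
    by rewrite /dot -sumrB; apply: eq_bigr => a _; ring.
  have := sqr_ge0 (dot (v k) y - 2 * dot (v k) z); nra.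
have nD (y z : 'I_rho -> R) : nsq y <= 2 * nsq z + 2 * nsq (fun a => z a - y a).
  rewrite /nsq !mulr_sumr -big_split /=; apply: ler_sum => a _.
  have := sqr_ge0 (y a - 2 * z a); nra.
have [x0|xp] := leP (nsq x) 0.
  by apply: le_trans (Q0 x); rewrite mulr_ge0_le0 // divr_ge0.
have Qsc (c : R) y : Q (fun a => c * y a) = c ^+ 2 * Q y.
  rewrite /Q mulr_sumr; apply: eq_bigr => k _; rewrite -exprMn; congr (_ ^+ 2).
  by rewrite /dot mulr_sumr; apply: eq_bigr => a _; ring.
have nsc (c : R) (y : 'I_rho -> R) : nsq (fun a => c * y a) = c ^+ 2 * nsq y.
  by rewrite /nsq mulr_sumr; apply: eq_bigr => a _; rewrite exprMn.
pose c := (Num.sqrt (nsq x))^-1.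
have c2 : c ^+ 2 * nsq x = 1.
  by rewrite /c exprVn sqr_sqrtr ?(ltW xp) // mulVf ?gt_eqF.
have cp : 0 < c ^+ 2 by rewrite exprn_gt0 // invr_gt0 sqrtr_gt0.
pose z a := c * x a.
have z1 : nsq z = 1 by rewrite nsc.
have [g zg] := grid_approx M0 z1.
have Mp : 0 < M%:R ^+ 2 :> R by rewrite exprn_gt0 // ltr0n.
have := gridQ g; set y := grid_point g in zg *; set d := nsq _ in zg => Qy.
have d0 : 0 <= d := nsq_ge0 _.
have h1 := QD y z; have h2 := QL (fun a => y a - z a).
have h3 := nD z y; rewrite -/d z1 in h3; rewrite -/d in h2.
have h4 : 16 * (L + 1 / 4) * d <= 1.
  apply: le_trans (_ : 16 * (L + 1 / 4) * (rho%:R / M%:R ^+ 2) <= _).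
    by rewrite ler_wpM2l // mulr_ge0 // addr_ge0.
  rewrite mulrA ler_pdivrMr // [leRHS]mul1r; apply: le_trans _ ML; lra.
rewrite -(ler_pM2l cp) -Qsc mulrCA c2 -/z mulr1.
have h5 : m * (16 * (L + 1 / 4) * d) <= m by rewrite -[leRHS]mulr1 ler_wpM2l.
have h6 : m * 1 <= m * (2 * nsq y + 2 * d) by rewrite ler_wpM2l.
rewrite -/(Q z); move: h1 h2 Qy h5 h6; rewrite -/(Q y); lra.
Qed.

Section Rows.
Variables (T F : finType) (rho : nat).
(** The Boolean selects the real or the imaginary part of a complex row, so that all quadratic forms
    are real sums. *)
Variables (u : T -> bool -> 'I_rho -> R) (w : T -> bool -> F -> R).
Hypothesis T0 : (0 < #|T|)%N.
Hypothesis avg_uu : forall a a',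
  avg (fun t => \sum_b u t b a * u t b a') = (a == a')%:R.

(** Union bound over the grid. At a grid point x the summand has mean |x|^2 by [avg_uu] and is at
    most L |x|^2 by Cauchy-Schwarz, so [chernoff_lower] applies with K = L. *)
Lemma embedding_failure (m M : nat) (L : R) :
  (0 < M)%N -> 0 < L -> 16 * rho%:R * (L + 1 / 4) <= M%:R ^+ 2 ->
  (forall t, \sum_b nsq (u t b) <= L) ->
  avg (fun f : {ffun 'I_m -> T} => (`[< exists x,
      \sum_k \sum_b dot (u (f k) b) x ^+ 2 < m%:R / 16 * nsq x >])%:R) <=
  (2 * M).+1%:R ^+ rho * expR (- (m%:R / (16 * L))) :> R.
Proof.
move=> M0 L0 ML uL.
pose Y (g : {ffun 'I_rho -> 'I_(2 * M).+1}) t := \sum_b dot (u t b) (grid_point g) ^+ 2.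
apply: le_trans (_ : avg (fun f : {ffun 'I_m -> T} =>
    \sum_g (\sum_k Y g (f k) < m%:R * nsq (grid_point g) / 2)%R%:R) <= _).
  apply: ler_avg => f; case: asboolP => [[x bad]|_]; last by rewrite sumr_ge0.
  have [/existsP[g gbad]|] := boolP [exists g : {ffun 'I_rho -> 'I_(2 * M).+1},
      \sum_k Y g (f k) < m%:R * nsq (grid_point g) / 2].
    by rewrite (bigD1 g) //= gbad lerDl sumr_ge0.
  rewrite negb_exists => /forallP good; suff : false by [].
  move: bad; rewrite ltNge => /negP[].
  rewrite pair_bigA /=.
  apply: (@grid_lower_bound _ _ M (fun p : 'I_m * bool => u (f p.1) p.2) m%:R L) => //.
  - exact: ltW.
  - rewrite -(pair_bigA _ (fun k b => nsq (u (f k) b))) /=.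
    apply: le_trans (_ : \sum_(k < m) L <= _); first by apply: ler_sum => k _.
    by rewrite sumr_const card_ord mulr_natl.
  - move=> g; have := good g; rewrite -leNgt /Y.
    by rewrite pair_bigA.
rewrite avg_sum.
have -> : (2 * M).+1%:R ^+ rho * expR (- (m%:R / (16 * L))) =
    \sum_(g : {ffun 'I_rho -> 'I_(2 * M).+1}) expR (- (m%:R / (16 * L))).
  by rewrite sumr_const card_ffun !card_ord -natrX mulr_natl.
apply: ler_sum => g _; apply: chernoff_lower => // [|t].
  set x := grid_point g.
  rewrite (@eq_avg _ _ _ (fun t => \sum_a \sum_a' (x a * x a') * \sum_b u t b a * u t b a')).
    rewrite avg_sum /nsq; apply: eq_bigr => a _; rewrite avg_sum (bigD1 a) //=.
    rewrite avgZ avg_uu eqxx mulr1 big1 ?addr0 // => a' aa'.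
    by rewrite avgZ avg_uu eq_sym (negPf aa') mulr0.
  move=> t; rewrite /Y.
  under [RHS]eq_bigr do (under eq_bigr do rewrite mulr_sumr; rewrite exchange_big /=).
  rewrite exchange_big /=; apply: eq_bigr => b _.
  rewrite expr2 {1}/dot mulr_suml; apply: eq_bigr => a _.
  rewrite /dot mulr_sumr; apply: eq_bigr => a' _; rewrite /x; ring.
rewrite sumr_ge0 => [|b _]; last by rewrite sqr_ge0.
apply: le_trans (_ : \sum_b nsq (u t b) * nsq (grid_point g) <= _).
  by apply: ler_sum => b _; exact: cauchy_schwarz.
by rewrite -mulr_suml ler_wpM2r ?nsq_ge0.
Qed.

(** [bernstein] is applied to the outer product Z of the rows of u and w. It is centred by
    orthogonality, |Z|^2 <= |u|^2 |w|^2 bounds it by L q L B, and its mean square is at most L q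
    B. *)
Lemma cross_term_failure (m p : nat) (L q B eps : R) :
  (0 < p)%N -> 0 < L -> 1 <= q -> 0 < eps <= 1 ->
  (400 * 500) * (p%:R * L * q) <= eps * m%:R ->
  (forall a c, avg (fun t => \sum_b u t b a * w t b c) = 0) ->
  avg (fun t => \sum_b nsq (w t b)) = B ->
  (forall t, \sum_b nsq (u t b) <= L * q) ->
  (forall t, \sum_b nsq (w t b) <= L * B) ->
  avg (fun f : {ffun 'I_m -> T} => (eps * m%:R ^+ 2 * B / 1024 <
     nsq (fun e => \sum_k \sum_b u (f k) b e.1 * w (f k) b e.2))%R%:R) <=
  (8 ^+ p)^-1 :> R.
Proof.
move=> p0 L0 q1 /andP[e0 e1] mK uw0 wB uL wL.
have x1 : 1 <= p%:R :> R by rewrite ler1n.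
have S0 t : 0 <= \sum_b nsq (w t b) by rewrite sumr_ge0 // => b _; exact: nsq_ge0.
have U0 t : 0 <= \sum_b nsq (u t b) by rewrite sumr_ge0 // => b _; exact: nsq_ge0.
have B0 : 0 <= B by rewrite -wB; exact: avg_ge0.
pose Z t (e : 'I_rho * F) := \sum_b u t b e.1 * w t b e.2.
have ZZ t : nsq (Z t) <= (\sum_b nsq (u t b)) * (\sum_b nsq (w t b)).
  have -> : \sum_b nsq (u t b) = \sum_a nsq (fun b => u t b a).
    by rewrite /nsq exchange_big.
  have -> : \sum_b nsq (w t b) = \sum_c nsq (fun b => w t b c).
    by rewrite /nsq exchange_big.
  rewrite {1}/nsq -(pair_bigA _ (fun a c => (\sum_b u t b a * w t b c) ^+ 2)) /=.
  rewrite mulr_suml; apply: ler_sum => a _; rewrite mulr_sumr; apply: ler_sum => c _.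
  exact: (cauchy_schwarz (fun b => u t b a) (fun b => w t b c)).
(* If B = 0, then w and the cross term vanish; this case is separated because [bernstein] requires c
   > 0. *)
move: (B0); rewrite le_eqVlt => /orP[/eqP B00|Bp].
  have w0 t b c : w t b c = 0.
    apply: nsq_eq0; apply: le_trans (_ : \sum_b nsq (w t b) <= _).
      by rewrite (bigD1 b) //= lerDl sumr_ge0 // => i _; exact: nsq_ge0.
    by have := wL t; rewrite -B00 mulr0.
  rewrite (@eq_avg _ _ _ (fun => 0)) => [|f].
    by apply: le_trans (avg_const_le _ (lexx 0)) _; rewrite invr_ge0 exprn_ge0.
  rewrite -B00 mulr0 mul0r [nsq _]big1 ?ltxx // => e _.
  by rewrite big1 ?expr0n // => k _; rewrite big1 // => b _; rewrite w0 mulr0.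
have qp : 0 < q by lra.
pose V := L * q * (L * B).
have Vp : 0 < V by rewrite !mulr_gt0.
pose c := 9 * p%:R ^+ 2 * V.
have pp : 0 < p%:R :> R by lra.
have cp : 0 < c by rewrite /c !mulr_gt0 // exprn_gt0.
have s0 : 0 <= L * q * B by rewrite !mulr_ge0 // ltW.
have ZV t : nsq (Z t) <= V by apply: le_trans (ZZ t) _; apply: ler_pM.
have Zs : avg (fun t => nsq (Z t)) <= L * q * B.
  apply: le_trans (_ : avg (fun t => L * q * \sum_b nsq (w t b)) <= _).
    by apply: ler_avg => t; apply: le_trans (ZZ t) _; rewrite ler_wpM2r.
  by rewrite avgZ wB.
have bern := bernstein m T0 p0 cp (lexx _) s0 (fun e => uw0 e.1 e.2) ZV Zs.
have t0 : 0 <= c + 10 * p%:R * m%:R * (L * q * B).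
  by rewrite addr_ge0 ?(ltW cp) // mulr_ge0 ?s0 // mulr_ge0 // mulr_ge0.
apply: le_trans (markov_pow p0 t0 (fun f => nsq_ge0 _) bern).
apply: ler_avg => f; rewrite ler_nat; case: ltP => //= h1; case: ltP => // h2; exfalso.
move: (lt_le_trans h1 h2); apply/negP; rewrite -leNgt.
pose k := p%:R * L * q; have k0 : 0 < k by rewrite !mulr_gt0.
have mp : 0 <= m%:R :> R by [].
rewrite /c /V.
(* With k = p L q both terms are multiples of k m, with factors 72 and 80 in total, and 152 / (400 *
   500) < 1 / 1024. *)
have -> : 8 * (9 * p%:R ^+ 2 * (L * q * (L * B)) + 10 * p%:R * m%:R * (L * q * B)) =
   (72 * (k * (p%:R * L)) + 80 * k * m%:R) * B by rewrite /k; ring.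
have -> : eps * m%:R ^+ 2 * B / 1024 = eps * m%:R ^+ 2 / 1024 * B by ring.
rewrite ler_wpM2r //.
have kL : p%:R * L <= k by rewrite /k ler_peMr // mulr_ge0 // ltW.
have km : k * (400 * 500) <= m%:R.
  by apply: le_trans (_ : eps * m%:R <= _); [rewrite mulrC|rewrite ler_piMl].
have h3 : m%:R * ((400 * 500) * k) <= m%:R * (eps * m%:R) by rewrite ler_wpM2l.
have h4 : k * (p%:R * L) <= k * m%:R.
  by rewrite ler_wpM2l ?(ltW k0) //; apply: le_trans kL _; move: km; lra.
have h5 : 0 <= k * m%:R by rewrite mulr_ge0 // ltW.
move: h3 h4 h5; lra.
Qed.

End Rows.

(** Expanding the square in the second assumption gives |u D|^2 <= 2 D . N, where N is the cross
    term of u and w. With the lower bound m |D|^2 / 16 on the left and Cauchy-Schwarz on the right,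
    m |D| <= 32 |N|, and 32^2 = 1024. *)
Lemma least_squares_perturbation (J F : finType) (rho : nat) (u : J -> 'I_rho -> R)
    (w : J -> F -> R) (D : 'I_rho -> F -> R) (m : R) :
  0 < m -> (forall x, m / 16 * nsq x <= \sum_j dot (u j) x ^+ 2) ->
  \sum_i \sum_j (w j i - \sum_a u j a * D a i) ^+ 2 <= \sum_i \sum_j w j i ^+ 2 ->
  m ^+ 2 * nsq (fun e => D e.1 e.2) <=
  1024 * nsq (fun e => \sum_j u j e.1 * w j e.2).
Proof.
move=> m0 low le0.
set nD := nsq _; set N := fun e => _; set nN := nsq _.
have D0 : 0 <= nD := nsq_ge0 _. have N0 : 0 <= nN := nsq_ge0 _.
pose x i a := D a i.
have nDE : nD = \sum_i nsq (x i).
  by rewrite /nD /nsq exchange_big /= pair_bigA.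
have h1 : m / 16 * nD <= 2 * dot (fun e => D e.1 e.2) N.
  apply: le_trans (_ : \sum_i \sum_j dot (u j) (x i) ^+ 2 <= _).
    by rewrite nDE mulr_sumr; apply: ler_sum => i _.
  have -> : dot (fun e => D e.1 e.2) N = \sum_i \sum_j w j i * dot (u j) (x i).
    rewrite /dot /N -(pair_bigA _ (fun a i => D a i * \sum_j u j a * w j i)) /=.
    rewrite exchange_big /=; apply: eq_bigr => i _.
    under eq_bigr do rewrite mulr_sumr.
    rewrite exchange_big /=; apply: eq_bigr => j _.
    by rewrite mulr_sumr; apply: eq_bigr => a _; rewrite /x; ring.
  move: le0; rewrite -subr_ge0 -sumrB => le0; rewrite -subr_ge0.
  rewrite mulr_sumr -sumrB; apply: le_trans le0 _.
  rewrite le_eqVlt; apply/orP; left; apply/eqP; apply: eq_bigr => i _.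
  rewrite mulr_sumr -!sumrB; apply: eq_bigr => j _.
  rewrite -/(dot (u j) (x i)); ring.
have := cauchy_schwarz (fun e => D e.1 e.2) N; rewrite -/nD -/nN; set d := dot _ _ in h1 *.
move=> dN; have [->|nDp] : nD = 0 \/ 0 < nD.
  by move: D0; rewrite le_eqVlt => /orP[/eqP <-|]; [left|right].
  by rewrite mulr0; apply: mulr_ge0 N0; exact: ler0n.
rewrite -(ler_pM2l nDp).
have h2 : (m / 16 * nD) ^+ 2 <= (2 * d) ^+ 2.
  apply: lerXn2r => //; rewrite nnegrE; last first.
    by apply: le_trans h1; rewrite mulr_ge0 // divr_ge0 // ltW.
  by rewrite mulr_ge0 // divr_ge0 // ltW.
rewrite exprMn expr_div_n in h2. nra.
Qed.

End Sampling.

(** * Gram-Schmidt and the discrete Fourier matrix *)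

Section GramSchmidt.
Variable R : realType.

Lemma cV_sqr_eq0 (P : nat) (v : 'cV[R]_P) : (v^T *m v) 0 0 <= 0 -> v = 0.
Proof.
rewrite mxE => h; apply/colP => i; rewrite mxE.
apply: (@nsq_eq0 R _ (fun i => v i 0)); apply: le_trans h.
by rewrite le_eqVlt; apply/orP; left; apply/eqP/eq_bigr => j _; rewrite mxE expr2.
Qed.

(** The first column is orthogonalized against a basis for the others and dropped if nothing
    remains. The matrix may be rank deficient, whence rho <= q; [Z] records that U has its columns
    in the range of A. *)
Lemma gram_schmidt (P q : nat) (A : 'M[R]_(P, q)) :
  exists rho (U : 'M[R]_(P, rho)) (Y : 'M[R]_(rho, q)) (Z : 'M[R]_(q, rho)),
    [/\ (rho <= q)%N, U^T *m U = 1%:M, A = U *m Y & U = A *m Z].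
Proof.
elim: q A => [|q IH]; last rewrite -[q.+1]/(1 + q)%N; move=> A.
  exists 0%N, 0, 0, 0; split => //; first by apply/matrixP => -[].
  - by rewrite mul0mx; apply/matrixP => i [].
  - by rewrite mulmx0.
rewrite -[A]hsubmxK; set v := lsubmx A; set B := rsubmx A.
have [rho [U [Y [Z [rq UU BU UB]]]]] := IH B.
pose x := v - U *m (U^T *m v).
have Ux : U^T *m x = 0 by rewrite /x mulmxBr !mulmxA UU mul1mx subrr.
have [x0|xp] := leP ((x^T *m x) 0 0) 0.
  have vU : v = U *m (U^T *m v) by apply/eqP; rewrite -subr_eq0 -/x (cV_sqr_eq0 x0).
  exists rho, U, (row_mx (U^T *m v) Y),
    (col_mx 0 Z); split => //.
  - exact: leqW.
  - by rewrite mul_mx_row -vU -BU.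
  - by rewrite mul_row_col mulmx0 add0r.
pose s := Num.sqrt ((x^T *m x) 0 0).
have s0 : s != 0 by rewrite gt_eqF // sqrtr_gt0.
have xx : x^T *m x = (s ^+ 2)%:M.
  by rewrite [LHS]mx11_scalar sqr_sqrtr // ltW.
exists (1 + rho)%N, (row_mx (s^-1 *: x) U), (block_mx s%:M 0 (U^T *m v) Y).
exists (block_mx (s^-1)%:M 0 (- s^-1 *: (Z *m (U^T *m v))) Z); split.
- by rewrite add1n ltnS.
- have xT : (s^-1 *: x)^T = s^-1 *: x^T by apply/matrixP => i j; rewrite !mxE.
  rewrite tr_row_mx mul_col_row xT -!scalemxAl -!scalemxAr xx scalerA.
  rewrite Ux scaler0 UU -[x^T *m U]trmxK trmx_mul trmxK Ux trmx0 scaler0.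
  rewrite scale_scalar_mx -expr2 -exprMn mulVf // expr1n.
  by rewrite -scalar_mx_block.
- rewrite mul_row_block mulmx0 add0r -BU mul_mx_scalar scalerA divff // scale1r.
  by rewrite subrK.
- rewrite mul_row_block mulmx0 add0r -UB mul_mx_scalar -scalemxAr (mulmxA B Z) -UB.
  by rewrite scaleNr -scalerBr.
Qed.

End GramSchmidt.

Section Fourier.
Variable R : realType.

(** The character exp(- i t). *)
Definition omega (t : R) : R[i] := Complex (cos t) (- sin t).

Lemma omegaD (s t : R) : omega (s + t) = omega s * omega t.
Proof.
rewrite /omega cosD sinD [RHS]/GRing.mul /= .
by congr Complex; ring.
Qed.

Lemma omega0 : omega 0 = 1.
Proof. by rewrite /omega cos0 sin0 oppr0. Qed.

Lemma omegaN (t : R) : omega (- t) = conjc (omega t).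
Proof. by rewrite /omega cosN sinN. Qed.

Lemma omega_natmul (t : R) k : omega (k%:R * t) = omega t ^+ k.
Proof.
elim: k => [|k IH]; first by rewrite mul0r omega0.
by rewrite -natr1 mulrDl mul1r omegaD IH exprSr.
Qed.

Lemma omega_2pi : omega (2 * pi) = 1.
Proof. by rewrite mulrC mulr_natr /omega cos2pi sin2pi oppr0. Qed.

Lemma omega_2pi_nat k : omega (2 * pi * k%:R) = 1.
Proof. by rewrite mulrC omega_natmul omega_2pi expr1n. Qed.

(** By the double angle formula cos(2 pi t) = 1 would force sin(pi |t|) = 0, although pi |t| lies
    strictly between 0 and pi. *)
Lemma omega_neq1 (t : R) : 0 < `|t| < 1 -> omega (2 * pi * t) != 1.
Proof.
move=> /andP[t0 t1]; apply/eqP => -[/= c1 _].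
have {c1} : cos ((pi * `|t|) *+ 2) = 1.
  rewrite -c1; have [h|h] := ger0P t; [|rewrite -[RHS]cosN].
    by congr cos; rewrite -mulr_natr; ring.
  by congr cos; rewrite -mulr_natr; ring.
have s0 : 0 < sin (pi * `|t|).
  by apply: sin_gt0_pi; rewrite mulr_gt0 ?pi_gt0 // -[ltRHS]mulr1 ltr_pM2l ?pi_gt0.
have : 0 < sin (pi * `|t|) ^+ 2 by rewrite exprn_gt0.
rewrite cos_mulr2n sin2cos2; lra.
Qed.

Lemma real_mulc (a x y : R) : a%:C%C * Complex x y = Complex (a * x) (a * y).
Proof. by rewrite [LHS]/GRing.mul /= !mul0r subr0 addr0. Qed.

Lemma conjcM (x y : R[i]) : conjc (x * y) = conjc x * conjc y.
Proof. exact: rmorphM. Qed.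

Lemma dftE p (j k : 'I_p) : dft R p j k =
  ((Num.sqrt p%:R)^-1)%:C%C * omega (2 * pi * (j * k)%:R / p%:R).
Proof.
by rewrite mxE /omega real_mulc mulrN ![(Num.sqrt p%:R)^-1 * _]mulrC.
Qed.

(** An entry of the Gram matrix is a geometric sum of powers of a p-th root of unity z, and z = 1
    exactly on the diagonal. *)
Lemma dft_unitary (p : nat) : (map_mx conjc (dft R p))^T *m dft R p = 1%:M.
Proof.
apply/matrixP => l l'; rewrite !mxE.
have p0 : (0 < p)%N by case: p l {l'} => [[]|].
have pR : p%:R != 0 :> R by rewrite pnatr_eq0 -lt0n.
pose z := omega (2 * pi * ((l'%:R - l%:R) / p%:R)).
have sp : Num.sqrt p%:R ^+ 2 = p%:R :> R by rewrite sqr_sqrtr.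
have s0 : Num.sqrt p%:R != 0 :> R by rewrite sqrtr_eq0 -ltNge ltr0n.
have -> : \sum_j (map_mx conjc (dft R p))^T l j * dft R p j l' =
    (p%:R^-1)%:C%C * \sum_(j < p) z ^+ j.
  rewrite mulr_sumr; apply: eq_bigr => j _.
  rewrite [X in X * _ = _]mxE [X in X * _ = _]mxE !dftE conjcM conjc_real -omegaN mulrACA.
  rewrite -omegaD -rmorphM -invfM -expr2 sp -omega_natmul; congr (_ * omega _).
  by rewrite !natrM; field.
have [ll|ll] := eqVneq l l'.
  rewrite /z -ll subrr mul0r mulr0 omega0.
  under eq_bigr do rewrite expr1n.
  by rewrite sumr_const card_ord -(rmorph_nat (real_complex R)) -rmorphM mulVf.
have z1 : z != 1.
  apply: omega_neq1.
  rewrite normr_gt0 mulf_eq0 invr_eq0 (negPf pR) orbF subr_eq0 eqr_nat eq_sym.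
  rewrite -(inj_eq val_inj) in ll; rewrite ll /= normrM normfV (ger0_norm (ler0n R p)).
  rewrite ltr_pdivrMr ?ltr0n // mul1r.
  have := ltn_ord l; have := ltn_ord l'; rewrite -!(ltr_nat R) => h1 h2.
  by rewrite ltr_norml; have : 0 <= l%:R :> R by []; have : 0 <= l'%:R :> R by []; lra.
have : z ^+ p = 1.
  rewrite -omega_natmul.
  have -> : p%:R * (2 * pi * ((l'%:R - l%:R) / p%:R)) =
     2 * pi * l'%:R + - (2 * pi * l%:R) :> R by field.
  by rewrite omegaD omegaN !omega_2pi_nat conjc1 mulr1.
move=> zp; have /eqP := subrX1 z p.
rewrite zp subrr eq_sym mulf_eq0 subr_eq0 (negPf z1) /= => /eqP ->.
by rewrite mulr0.
Qed.

End Fourier.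

(** * Kronecker sign chaoses *)

Section KroneckerChaos.
Variables (R : realType) (N : nat) (I : 'I_N -> nat) (n : 'I_N).

Definition mode_sign (d : signs I n) (j : 'I_N) (i : 'I_(I j)) : R :=
  if insub (Tagged (fun j => 'I_(I j)) i) is Some u then (-1) ^+ d u else 1.

(** The diagonal of the Kronecker product of the sign matrices, by the same recursion as [kron]. *)
Fixpoint sign_prod (d : signs I n) (a : 'I_N) (k : nat) : 'I_(cdim I a k) -> R :=
  match k return 'I_(cdim I a k) -> R with
  | 0 => fun _ => 1
  | k'.+1 => fun c => mode_sign d (mxtens_unindex c).1 *
                      @sign_prod d a k' (mxtens_unindex c).2
  end.

Lemma sign_prodS (d : signs I n) (a : 'I_N) (k : nat) i (c : 'I_(cdim I a k)) :
  @sign_prod d a k.+1 (mxtens_index (i, c)) = mode_sign d i * sign_prod d c.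
Proof.
exact: (congr1 (fun x => mode_sign d x.1 * sign_prod d x.2) (mxtens_indexK (i, c))).
Qed.

Lemma sign_prod_sqr (d : signs I n) (a : 'I_N) (k : nat) (c : 'I_(cdim I a k)) :
  sign_prod d c ^+ 2 = 1.
Proof.
elim: k c => [|k IH] c /=; first by rewrite expr1n.
rewrite exprMn IH mulr1 /mode_sign; case: insub => [u|]; last by rewrite expr1n.
exact: sqrr_sign.
Qed.

Lemma kron_signE (d : signs I n) (a : 'I_N) (k : nat) (c t : 'I_(cdim I a k)) :
  kron (fun j => dft R (I j) *m complexmx (sign_diag R d j)) a k c t =
  kron (fun j => dft R (I j)) a k c t * (sign_prod d t)%:C%C.
Proof.
elim: k c t => [|k IH] c t; cbn [kron sign_prod]; first by rewrite rmorph1 mulr1.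
rewrite mxE [X in _ = X * _]mxE IH rmorphM !mulrA; congr (_ * _).
rewrite [RHS]mulrAC; congr (_ * _).
by rewrite /complexmx /sign_diag map_diag_mx mul_mx_diag !mxE.
Qed.

Lemma kron_dft_unitary (a : 'I_N) (k : nat) :
  (map_mx conjc (kron (fun j => dft R (I j)) a k))^T *m kron (fun j => dft R (I j)) a k
  = 1%:M.
Proof.
elim: k => [|k IH] /=.
  by rewrite map_scalar_mx tr_scalar_mx rmorph1 mulmx1.
rewrite map_mxT trmx_tens tensmx_mul IH dft_unitary.
apply/matrixP => c c'.
case: (mxtens_indexP c) => i j; case: (mxtens_indexP c') => i' j'.
rewrite tensmxE !mxE -natrM mulnb; congr (_%:R); congr nat_of_bool.
by rewrite -xpair_eqE (can_eq (@mxtens_indexK _ _)).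
Qed.

Lemma kron_dft_normc (a : 'I_N) (k : nat) (c t : 'I_(cdim I a k)) :
  Normc.normc (kron (fun j => dft R (I j)) a k c t) ^+ 2 = ((cdim I a k)%:R)^-1.
Proof.
elim: k c t => [|k IH] c t /=.
  rewrite mxE (_ : c = t) ?eqxx ?Normc.normc1 ?expr1n ?invr1 //.
  by apply/val_inj; rewrite [c]ord1 [t]ord1.
rewrite mxE Normc.normcM exprMn IH natrM invfM; congr (_ * _).
rewrite mxE /= sqr_sqrtr ?addr_ge0 ?sqr_ge0 // sqrrN !exprMn -mulrDl cos2Dsin2 mul1r.
by rewrite exprVn sqr_sqrtr.
Qed.

Lemma sum_mxtens (V : nmodType) (p q : nat) (F : 'I_(p * q) -> V) :
  \sum_c F c = \sum_i \sum_j F (mxtens_index (i, j)).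
Proof.
rewrite pair_bigA /= (reindex (@mxtens_index p q)) /=.
  by apply: eq_bigr => -[].
by exists (@mxtens_unindex p q) => x _; rewrite ?mxtens_indexK ?mxtens_unindexK.
Qed.

Lemma sign_prod_upd (d : signs I n) u b k (c : 'I_(cdim I (ordS n) k)) :
  (forall p, (p < k)%N -> Defs.shift (ordS n) p != tag (val u)) ->
  sign_prod (upd d u b) c = sign_prod d c.
Proof.
elim: k c => [//|k IH] c uk /=; rewrite IH => [|p pk]; last exact/uk/ltnW.
congr (_ * _); rewrite /mode_sign; case: insubP => // v _ vE.
rewrite upd_other //; apply: contra (uk k (ltnSn k)) => /eqP <-.
by rewrite vE.
Qed.

(** Induction on the number of modes. [khintchine] over the signs of the last mode contributes one
    factor 4 p and leaves the squared norm of a chaos of order k, whose values lie in the larger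
    space indexed by ['I_(I j) * E]. *)
Lemma chaos_moment (p k : nat) (E : finType) (b : 'I_(cdim I (ordS n) k) -> E -> R) :
  (k <= N.-1)%N ->
  avg (fun d : signs I n => nsq (fun e => \sum_c sign_prod d c * b c e) ^+ p) <=
  ((4 * p%:R) ^+ k * \sum_c nsq (b c)) ^+ p.
Proof.
elim: k E b => [|k IH] E b kN.
  rewrite expr0 mul1r.
  apply: le_trans (@avg_const_le R (signs I n) _ (exprn_ge0 p (_ : 0 <= \sum_c nsq (b c)))).
    apply: ler_avg => d; rewrite le_eqVlt; apply/orP; left; apply/eqP; congr (_ ^+ p).
    by rewrite /= big_ord1; apply: eq_bigr => e _; rewrite big_ord1 mul1r.
  by rewrite sumr_ge0 // => c _; exact: nsq_ge0.
set j := Defs.shift (ordS n) k.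
have jn : j != n by rewrite shift_neqE; apply/existsP; exists (Ordinal kN).
have pn (i : 'I_(I j)) : tag (Tagged (fun j => 'I_(I j)) i) != n by [].
pose u (i : 'I_(I j)) : {x : {j : 'I_N & 'I_(I j)} | tag x != n} :=
  exist (fun x : {j : 'I_N & 'I_(I j)} => tag x != n) _ (pn i).
have uI : injective u.
  by move=> i i' /(congr1 val) /= /eqP; rewrite eq_Tagged => /eqP.
pose g (i : 'I_(I j)) (d : signs I n) e :=
  \sum_c sign_prod d c * b (mxtens_index (i, c)) e.
(* The modes [shift (ordS n) q] with q < N - 1 are distinct, so the remaining coefficients do not
   see the signs of mode j. *)
have gu i i' d bb : g i (upd d (u i') bb) = g i d.
  apply/funext => e; apply: eq_bigr => c _; rewrite sign_prod_upd // => q qk.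
  apply/eqP => qj.
  have := @shift_neq_inj N n (Ordinal (ltn_trans qk kN)) (Ordinal kN) qj.
  by move=> /(congr1 val) /= qE; rewrite qE ltnn in qk.
apply: le_trans (_ : avg (fun d : signs I n =>
    nsq (fun e => \sum_i (-1) ^+ d (u i) * g i d e) ^+ p) <= _).
  apply: ler_avg => d; rewrite le_eqVlt; apply/orP; left; apply/eqP; congr (_ ^+ p).
  apply: eq_bigr => e _; congr (_ ^+ 2); rewrite sum_mxtens; apply: eq_bigr => i _.
  rewrite /g mulr_sumr; apply: eq_bigr => c _; rewrite sign_prodS -mulrA.
  congr (_ * _).
  by rewrite /mode_sign (insubT (fun x : {j : 'I_N & 'I_(I j)} => tag x != n) (pn i)).
apply: le_trans (khintchine p uI gu) _.
pose b' c (ie : 'I_(I j) * E) := b (mxtens_index (ie.1, c)) ie.2.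
rewrite (@eq_avg _ _ _ (fun d : signs I n => (4 * p%:R) ^+ p *
    nsq (fun e => \sum_c sign_prod d c * b' c e) ^+ p)); last first.
  move=> d; rewrite exprMn; congr (_ * _ ^+ p).
  by rewrite /nsq pair_bigA.
rewrite avgZ exprSr -mulrA [X in _ <= X ^+ p]mulrCA [leRHS]exprMn.
rewrite ler_wpM2l ?exprn_ge0 ?mulr_ge0 //.
apply: le_trans (IH _ b' (ltnW kN)) _.
rewrite le_eqVlt; apply/orP; left; apply/eqP; congr ((_ * _) ^+ p).
rewrite sum_mxtens [RHS]exchange_big; apply: eq_bigr => c _.
by rewrite /nsq pair_bigA.
Qed.

End KroneckerChaos.

(** * Rows of the randomized Fourier transform *)

Section Frobenius.
Variable R : realType.

Definition frob2 (p q : nat) (A : 'M[R]_(p, q)) : R := \sum_i \sum_j A i j ^+ 2.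

Lemma frob2_ge0 (p q : nat) (A : 'M[R]_(p, q)) : 0 <= frob2 A.
Proof. by do 2!apply: sumr_ge0 => ? _; exact: sqr_ge0. Qed.

Lemma frob2_trace (p q : nat) (A : 'M[R]_(p, q)) : frob2 A = \tr (A *m A^T).
Proof.
by apply: eq_bigr => i _; rewrite mxE; apply: eq_bigr => j _; rewrite mxE expr2.
Qed.

Lemma frob2_orthonormal (p q : nat) (U : 'M[R]_(p, q)) :
  U^T *m U = 1%:M -> frob2 U = q%:R.
Proof. by move=> UU; rewrite frob2_trace mxtrace_mulC UU mxtrace1. Qed.

Lemma frob2_pythagoras (c p q : nat) (W : 'M[R]_(c, p)) (E : 'M[R]_(c, q))
    (U : 'M[R]_(p, q)) :
  U^T *m U = 1%:M -> W *m U = 0 -> frob2 (W - E *m U^T) = frob2 W + frob2 E.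
Proof.
move=> UU WU; rewrite !frob2_trace -mxtraceD; congr (\tr _).
have UW : U^T *m W^T = 0 by rewrite -trmx_mul WU trmx0.
rewrite linearB /= trmx_mul trmxK mulmxBl !mulmxBr.
rewrite [W *m (U *m _)]mulmxA WU mul0mx subr0 -[E *m U^T *m W^T]mulmxA UW mulmx0 sub0r.
by rewrite opprK mulmxA -[E *m U^T *m U]mulmxA UU mulmx1.
Qed.

End Frobenius.

Section FourierRows.
Variables (R : realType) (N : nat) (I : 'I_N -> nat) (n : 'I_N).
Local Notation P := (cdim_neq I n).
Local Notation H := (kron (fun j => dft R (I j)) (ordS n) N.-1 : 'M[R[i]]_P).

Definition fourier_part (t : 'I_P) (b : bool) (s : 'I_P) : R :=
  if b then complex.Re (H t s) else complex.Im (H t s).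

(** The factor sqrt P makes the transform an isometry when a row is drawn uniformly, see
    [fourier_row_isometry]. *)
Definition fourier_row (x : 'I_P -> R) (t : 'I_P) (b : bool) : R :=
  Num.sqrt P%:R * \sum_s fourier_part t b s * x s.

Lemma normc_sqr (z : R[i]) : Normc.normc z ^+ 2 = complex.Re z ^+ 2 + complex.Im z ^+ 2.
Proof. by case: z => a b /=; rewrite sqr_sqrtr // addr_ge0 ?sqr_ge0. Qed.

Lemma fourier_part_norm t s : \sum_b fourier_part t b s ^+ 2 = P%:R^-1.
Proof. by rewrite big_bool /= -normc_sqr kron_dft_normc. Qed.

Lemma Re_sum (J : finType) (F : J -> R[i]) :
  complex.Re (\sum_j F j) = \sum_j complex.Re (F j).
Proof. by apply: (big_morph (@complex.Re R)) => // -[? ?] [? ?]. Qed.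

Lemma Im_sum (J : finType) (F : J -> R[i]) :
  complex.Im (\sum_j F j) = \sum_j complex.Im (F j).
Proof. by apply: (big_morph (@complex.Im R)) => // -[? ?] [? ?]. Qed.

(** Real part of the unitarity relation of the Kronecker product. *)
Lemma fourier_part_orthonormal s s' :
  \sum_t \sum_b fourier_part t b s * fourier_part t b s' = (s == s')%:R.
Proof.
have /matrixP/(_ s s')/(congr1 (@complex.Re R)) := @kron_dft_unitary R N I (ordS n) N.-1.
rewrite mxE Re_sum => h.
transitivity (complex.Re ((1%:M : 'M[R[i]]_P) s s')); last by rewrite mxE; case: eqP.
rewrite -h; apply: eq_bigr => t _; rewrite big_bool !mxE /=.
rewrite /fourier_part; case: (H t s) => a b; case: (H t s') => a' b' /=; ring.
Qed.

Lemma fourier_row_isometry (x y : 'I_P -> R) :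
  (0 < P)%N ->
  avg (fun t => \sum_b fourier_row x t b * fourier_row y t b) = \sum_s x s * y s.
Proof.
move=> P0; have Pn : P%:R != 0 :> R by rewrite pnatr_eq0 -lt0n.
rewrite /avg card_ord.
transitivity (\sum_s \sum_s' x s * y s' *
    \sum_t \sum_b fourier_part t b s * fourier_part t b s').
  rewrite mulr_suml.
  under [RHS]eq_bigr do (under eq_bigr do rewrite mulr_sumr; rewrite exchange_big /=).
  rewrite [RHS]exchange_big; apply: eq_bigr => t _.
  under [RHS]eq_bigr do (under eq_bigr do rewrite mulr_sumr; rewrite exchange_big /=).
  rewrite [RHS]exchange_big /= mulr_suml; apply: eq_bigr => b _.
  rewrite /fourier_row mulrACA -expr2 sqr_sqrtr // mulrAC divff // mul1r.
  rewrite mulr_suml; apply: eq_bigr => s _; rewrite mulr_sumr; apply: eq_bigr => s' _.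
  ring.
apply: eq_bigr => s _; rewrite (bigD1 s) //= fourier_part_orthonormal eqxx mulr1.
rewrite big1 ?addr0 // => s' ss'.
by rewrite fourier_part_orthonormal eq_sym (negPf ss') mulr0.
Qed.

Definition dsign (d : signs I n) (s : 'I_P) : R := sign_prod R d s.

Lemma dsign_sqr d s : dsign d s ^+ 2 = 1.
Proof. exact: sign_prod_sqr. Qed.

(* Every entry of the Fourier matrix has modulus [P ^ (- 1/2)], so each row of the
   transform is a sign chaos whose coefficients carry the full norm of [V]. *)
Lemma coherence_failure (E : finType) (V : 'I_P -> E -> R) (p : nat) :
  (0 < P)%N -> (0 < p)%N ->
  avg (fun d : signs I n => (`[< exists t,
    8 * ((4 * p%:R) ^+ N.-1 * \sum_s nsq (V s)) <
    \sum_b nsq (fun e => fourier_row (fun s => dsign d s * V s e) t b) >])%:R) <=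
  P%:R * (8 ^+ p)^-1 :> R.
Proof.
move=> P0 p0; set S := _ * \sum_s _.
have Pn : P%:R != 0 :> R by rewrite pnatr_eq0 -lt0n.
have S0 : 0 <= S.
  by rewrite mulr_ge0 ?exprn_ge0 ?mulr_ge0 // sumr_ge0 // => s _; exact: nsq_ge0.
pose X (d : signs I n) t :=
  \sum_b nsq (fun e => fourier_row (fun s => dsign d s * V s e) t b).
apply: le_trans (_ : avg (fun d : signs I n => \sum_t (8 * S < X d t)%R%:R) <= _).
  apply: ler_avg => d; case: asboolP => [[t tb]|_]; last by rewrite sumr_ge0.
  by rewrite (bigD1 t) //= /X tb lerDl sumr_ge0.
rewrite avg_sum.
have -> : P%:R * (8 ^+ p)^-1 = \sum_(t < P) (8 ^+ p)^-1 :> R.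
  by rewrite sumr_const card_ord mulr_natl.
apply: ler_sum => t _; apply: markov_pow => // [d|].
  by apply: sumr_ge0 => b _; exact: nsq_ge0.
pose b' (s : 'I_P) (be : bool * E) := Num.sqrt P%:R * fourier_part t be.1 s * V s be.2.
have -> : S = (4 * p%:R) ^+ N.-1 * \sum_s nsq (b' s).
  congr (_ * _); apply: eq_bigr => s _; rewrite /nsq /b'.
  rewrite -(pair_bigA _ (fun b e => (Num.sqrt P%:R * fourier_part t b s * V s e) ^+ 2)) /=.
  transitivity (P%:R * (\sum_b fourier_part t b s ^+ 2) * \sum_e V s e ^+ 2).
    by rewrite fourier_part_norm divff // mul1r.
  rewrite -mulrA mulr_suml mulr_sumr; apply: eq_bigr => b _.
  by rewrite !mulr_sumr; apply: eq_bigr => e _; rewrite !exprMn sqr_sqrtr // mulrA.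
apply: le_trans (chaos_moment p b' (leqnn _)).
apply: ler_avg => d; rewrite le_eqVlt; apply/orP; left; apply/eqP; congr (_ ^+ p).
rewrite /X /nsq -(pair_bigA _ (fun b e => (\sum_s sign_prod R d s * b' s (b, e)) ^+ 2)) /=.
apply: eq_bigr => b _; apply: eq_bigr => e _; congr (_ ^+ 2).
rewrite /fourier_row mulr_sumr; apply: eq_bigr => s _; rewrite /b' /dsign /=; ring.
Qed.

(** By linearity the sketch acts on the real residual B - G A^T. Of the scaling P/m of the squared
    sketch, P is absorbed by [fourier_row] and 1/m remains in front. *)
Lemma sketched_frob2 (m c q : nat) (w : rows I n m * signs I n) (A : 'M[R]_(P, q))
    (B : 'M[R]_(c, P)) (G : 'M[R]_(c, q)) :
  frobC (complexmx B *m (ksrft R w)^T - complexmx G *m (ksrft R w *m complexmx A)^T) ^+ 2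
  = m%:R^-1 * \sum_i \sum_k \sum_b
      fourier_row (fun s => dsign w.2 s * (B - G *m A^T) i s) (w.1 k) b ^+ 2.
Proof.
have -> : complexmx B *m (ksrft R w)^T - complexmx G *m (ksrft R w *m complexmx A)^T =
    complexmx (B - G *m A^T) *m (ksrft R w)^T.
  rewrite trmx_mul mulmxA -mulmxBl; congr (_ *m _).
  by rewrite /complexmx map_mxB map_mxM map_trmx.
set D := B - _; rewrite /frobC sqr_sqrtr; last first.
  by do 2!apply: sumr_ge0 => ? _; exact: sqr_ge0.
rewrite mulr_sumr; apply: eq_bigr => i _; rewrite mulr_sumr; apply: eq_bigr => k _.
rewrite normc_sqr big_bool /=.
have entry s : ksrft R w k s = (Num.sqrt (P%:R / m%:R) * dsign w.2 s)%:C%C * H (w.1 k) s.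
  rewrite /ksrft -cdim_neqE /complexmx.
  have -> : map_mx (real_complex R) (rowsub w.1 1%:M) = rowsub w.1 1%:M.
    by apply/matrixP => x y; rewrite !mxE rmorph_nat.
  rewrite -rowsubE mxE mxE kron_signE rmorphM -!mulrA; congr (_ * _).
  by rewrite mulrC.
have -> : (complexmx D *m (ksrft R w)^T) i k =
    \sum_s (Num.sqrt (P%:R / m%:R) * (dsign w.2 s * D i s))%:C%C * H (w.1 k) s.
  rewrite mxE; apply: eq_bigr => s _; rewrite [X in _ * X = _]mxE entry [complexmx D i s]mxE.
  rewrite mulrA -rmorphM; congr (_ %:C%C * _).
  by ring.
rewrite Re_sum Im_sum.
have ReM (a : R) (z : R[i]) : complex.Re (a%:C%C * z) = a * complex.Re z.
  by case: z => x y; rewrite real_mulc.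
have ImM (a : R) (z : R[i]) : complex.Im (a%:C%C * z) = a * complex.Im z.
  by case: z => x y; rewrite real_mulc.
have key b : \sum_s Num.sqrt (P%:R / m%:R) * (dsign w.2 s * D i s) * fourier_part (w.1 k) b s
    = Num.sqrt m%:R^-1 * fourier_row (fun s => dsign w.2 s * D i s) (w.1 k) b.
  rewrite /fourier_row !mulr_sumr; apply: eq_bigr => s _.
  by rewrite sqrtrM //; ring.
rewrite mulrDr -[in RHS](@sqr_sqrtr _ m%:R^-1) ?invr_ge0 // -!exprMn -!key.
by congr (_ ^+ 2 + _ ^+ 2); apply: eq_bigr => s _; rewrite ?ReM ?ImM.
Qed.

End FourierRows.

(** * Success probability of the sketch *)

Section Sketch.
Variables (R : realType) (N : nat) (I : 'I_N -> nat) (n : 'I_N).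
Local Notation P := (cdim_neq I n).

Lemma fourier_rowB (x y : 'I_P -> R) t b :
  fourier_row (fun s => x s - y s) t b = fourier_row x t b - fourier_row y t b.
Proof.
rewrite /fourier_row -mulrBr -sumrB; congr (_ * _); apply: eq_bigr => s _; ring.
Qed.

Lemma fourier_row_lin (J : finType) (c : J -> R) (x : J -> 'I_P -> R) t b :
  fourier_row (fun s => \sum_j c j * x j s) t b = \sum_j c j * fourier_row (x j) t b.
Proof.
rewrite /fourier_row.
have -> : \sum_s fourier_part R t b s * (\sum_j c j * x j s) =
    \sum_s \sum_j fourier_part R t b s * (c j * x j s).
  by apply: eq_bigr => s _; rewrite mulr_sumr.
rewrite exchange_big mulr_sumr; apply: eq_bigr => j _; rewrite mulrCA; congr (_ * _).
by rewrite mulr_sumr; apply: eq_bigr => s _; rewrite mulrCA.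
Qed.

Lemma eq_fourier_row (x y : 'I_P -> R) t b :
  x =1 y -> fourier_row x t b = fourier_row y t b.
Proof.
by move=> xy; rewrite /fourier_row; congr (_ * _); apply: eq_bigr => s _; rewrite xy.
Qed.

(** The counterpart of [sketch_succeeds] for arbitrary real matrices in place of the two
    unfoldings. *)
Definition near_optimal (c q m : nat) (A : 'M[R]_(P, q)) (B : 'M[R]_(c, P)) (eps : R)
    (w : rows I n m * signs I n) : Prop :=
  forall Gt, is_argmin (fun G => frobC (complexmx B *m (ksrft R w)^T -
      complexmx G *m (ksrft R w *m complexmx A)^T)) Gt ->
    frob (B - Gt *m A^T) <= (1 + eps) * min_value (fun G => frob (B - G *m A^T)).

(** For orthonormal U, the squared norms of these rows, summed over b, are P times the leverage
    scores of the transformed matrix. *)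
Definition lev_row rho (U : 'M[R]_(P, rho)) (d : signs I n) t b (a : 'I_rho) : R :=
  fourier_row (fun s => dsign R d s * U s a) t b.

Lemma avg_lev_row rho1 rho2 (U : 'M[R]_(P, rho1)) (V : 'M[R]_(P, rho2)) d a a' :
  (0 < P)%N ->
  avg (fun t => \sum_b lev_row U d t b a * lev_row V d t b a') = (U^T *m V) a a'.
Proof.
move=> P0; rewrite fourier_row_isometry // mxE; apply: eq_bigr => s _.
by rewrite mulrACA -expr2 dsign_sqr mul1r mxE.
Qed.

(** The deterministic part. The sketched minimizer does at least as well on the sketch as the true
    minimizer [G0], so [least_squares_perturbation] bounds its error E by |E|^2 <= eps |W|^2.
    Pythagoras gives the squared residual |W|^2 + |E|^2 <= (1 + eps)^2 |W|^2. *)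
Lemma near_optimal_of_events (c q rho m : nat) (A : 'M[R]_(P, q)) (B : 'M[R]_(c, P))
    (U : 'M[R]_(P, rho)) (Y : 'M[R]_(rho, q)) (Z : 'M[R]_(q, rho)) (eps : R)
    (f : rows I n m) (d : signs I n) (W := B - B *m U *m U^T) :
  (0 < m)%N -> 0 <= eps ->
  U^T *m U = 1%:M -> A = U *m Y -> U = A *m Z ->
  (forall x, m%:R / 16 * nsq x <= \sum_k \sum_b dot (lev_row U d (f k) b) x ^+ 2) ->
  nsq (fun e => \sum_k \sum_b lev_row U d (f k) b e.1 * lev_row W^T d (f k) b e.2) <=
    eps * m%:R ^+ 2 * frob2 W / 1024 ->
  near_optimal A B eps (f, d).
Proof.
move=> m0 e0 UU AUY UAZ low cross Gt opt.
have mp : 0 < m%:R :> R by rewrite ltr0n.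
(* From U = A Z = U Y Z, cancelling U on the left. Hence Y^T has the left inverse Z^T, and G Y^T = B
   U is solvable for G. *)
have YZ : Y *m Z = 1%:M.
  by rewrite -[LHS]mul1mx -UU -mulmxA [U *m _]mulmxA -AUY -UAZ.
have WU : W *m U = 0 by rewrite mulmxBl -[B *m U *m U^T *m U]mulmxA UU mulmx1 subrr.
pose Er (G : 'M[R]_(c, q)) := G *m Y^T - B *m U.
have resE G : B - G *m A^T = W - Er G *m U^T.
  by rewrite AUY trmx_mul /W /Er mulmxBl mulmxA opprB addrA subrK.
have resF G : frob2 (B - G *m A^T) = frob2 W + frob2 (Er G).
  by rewrite resE frob2_pythagoras.
pose G0 := B *m U *m Z^T.
have E0 : Er G0 = 0 by rewrite /Er /G0 -mulmxA -trmx_mul YZ trmx1 mulmx1 subrr.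
pose F G := frobC (complexmx B *m (ksrft R (f, d))^T -
  complexmx G *m (ksrft R (f, d) *m complexmx A)^T).
have sk G : F G ^+ 2 =
    m%:R^-1 * \sum_i \sum_(kb : 'I_m * bool) (lev_row W^T d (f kb.1) kb.2 i -
       \sum_a lev_row U d (f kb.1) kb.2 a * (Er G)^T a i) ^+ 2.
  rewrite /F sketched_frob2; congr (_ * _); apply: eq_bigr => i _.
  rewrite pair_bigA; apply: eq_bigr => -[k b] _ /=; congr (_ ^+ 2).
  rewrite /lev_row; under [X in _ = _ - X]eq_bigr do rewrite mulrC.
  rewrite -fourier_row_lin -fourier_rowB; apply: eq_fourier_row => s.
  rewrite resE !mxE mulrBr mulr_sumr; congr (_ - _).
  by apply: eq_bigr => a _; rewrite !mxE mulrCA.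
have Wge0 := frob2_ge0 W.
have close : frob2 (Er Gt) <= eps * frob2 W.
  have le0 : F Gt ^+ 2 <= F G0 ^+ 2.
    by apply: lerXn2r (opt G0); rewrite nnegrE sqrtr_ge0.
  move: le0; rewrite !sk ler_pM2l ?invr_gt0 // E0.
  under [X in _ <= X]eq_bigr => i _.
    under eq_bigr => kb _.
      rewrite big1 => [|a _]; last by rewrite !mxE mulr0.
      rewrite subr0; over.
    over.
  move=> le1.
  have low' x : m%:R / 16 * nsq x <=
      \sum_(kb : 'I_m * bool) dot (lev_row U d (f kb.1) kb.2) x ^+ 2.
    by apply: le_trans (low x) _; rewrite pair_bigA.
  have := least_squares_perturbation mp low' le1.
  have -> : nsq (fun e : 'I_rho * 'I_c => (Er Gt)^T e.1 e.2) = frob2 (Er Gt).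
    rewrite /nsq -(pair_bigA _ (fun a i => (Er Gt)^T a i ^+ 2)) /= exchange_big /=.
    by apply: eq_bigr => i _; apply: eq_bigr => a _; rewrite mxE.
  move=> h; rewrite -(ler_pM2l (exprn_gt0 2 mp)); apply: le_trans h _.
  have -> : m%:R ^+ 2 * (eps * frob2 W) = 1024 * (eps * m%:R ^+ 2 * frob2 W / 1024).
    by field.
  apply: ler_wpM2l; first exact: ler0n.
  apply: le_trans cross; rewrite le_eqVlt; apply/orP; left; apply/eqP.
  by apply: eq_bigr => e _; rewrite pair_bigA.
have minle : Num.sqrt (frob2 W) <= min_value (fun G => frob (B - G *m A^T)).
  apply: lb_le_inf; first by exists (frob (B - G0 *m A^T)), G0.
  move=> _ [G _ <-]; rewrite /frob -/(frob2 _) resF.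
  by rewrite ler_wsqrtr // lerDl frob2_ge0.
apply: le_trans (_ : (1 + eps) * Num.sqrt (frob2 W) <= _); last first.
  by rewrite ler_wpM2l // addr_ge0.
have -> : (1 + eps) * Num.sqrt (frob2 W) = Num.sqrt ((1 + eps) ^+ 2 * frob2 W).
  by rewrite sqrtrM ?sqr_ge0 // sqrtr_sqr ger0_norm // addr_ge0.
rewrite /frob -/(frob2 _) resF ler_wsqrtr //; nra.
Qed.

(** Union bound over four events: large rows for U, large rows for W^T, a large cross term, and a
    failed lower bound on the quadratic form. The first two depend on the signs only, and the other
    two are bounded over the rows for each fixed good choice of signs. *)
Lemma sketch_failure (c q m p M : nat) (A : 'M[R]_(P, q)) (B : 'M[R]_(c, P)) (eps : R)
    (L := 8 * (4 * p%:R) ^+ N.-1 : R) :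
  (0 < P)%N -> (0 < m)%N -> (0 < p)%N -> (0 < q)%N -> (0 < M)%N -> 0 < eps <= 1 ->
  16 * q%:R * (L * q%:R + 1 / 4) <= M%:R ^+ 2 ->
  400 * 500 * (p%:R * L * q%:R) <= eps * m%:R ->
  1 - (2 * P%:R * (8 ^+ p)^-1 + (8 ^+ p)^-1 +
       (2 * M).+1%:R ^+ q * expR (- (m%:R / (16 * (L * q%:R))))) <=
  unif_prob R (near_optimal A B eps (m := m)).
Proof.
move=> P0 m0 p0 q0 M0 eps01 ML mL; have /andP[e0 e1] := eps01.
have [rho [U [Y [Z [rq UU AUY UAZ]]]]] := gram_schmidt A.
pose W := B - B *m U *m U^T.
have WU : W *m U = 0 by rewrite mulmxBl -[B *m U *m U^T *m U]mulmxA UU mulmx1 subrr.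
have p1 : 1 <= p%:R :> R by rewrite ler1n.
have L0 : 0 < L by rewrite mulr_gt0 // exprn_gt0 // mulr_gt0 // ltr0n.
have q1 : 1 <= q%:R :> R by rewrite ler1n.
have rq' : rho%:R <= q%:R :> R by rewrite ler_nat.
have Lq0 : 0 < L * q%:R by rewrite mulr_gt0 // (lt_le_trans ltr01).
have T0 : (0 < #|'I_P|)%N by rewrite card_ord.
set D3 := _ * expR _; set D1 := (8 ^+ p)^-1.
pose badL c' (V : 'M[R]_(P, c')) (d : signs I n) := `[< exists t,
    8 * ((4 * p%:R) ^+ N.-1 * \sum_s nsq (V s)) <
    \sum_b nsq (fun e => fourier_row (fun s => dsign R d s * V s e) t b) >].
have badP c' (V : 'M[R]_(P, c')) : avg (fun d => (badL c' V d)%:R) <= P%:R * D1.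
  exact: coherence_failure.
have goodL c' (V : 'M[R]_(P, c')) d t : ~~ badL c' V d ->
    \sum_b nsq (lev_row V d t b) <= L * frob2 V.
  move=> /asboolPn good; rewrite /L -mulrA leNgt; apply/negP => h.
  by apply: good; exists t.
have uu d (a a' : 'I_rho) :
    avg (fun t => \sum_b lev_row U d t b a * lev_row U d t b a') = (a == a')%:R.
  by rewrite avg_lev_row // UU mxE.
have uw d a i : avg (fun t => \sum_b lev_row U d t b a * lev_row W^T d t b i) = 0.
  by rewrite avg_lev_row // -trmx_mul WU trmx0 mxE.
have ww d : avg (fun t => \sum_b nsq (lev_row W^T d t b)) = frob2 W.
  rewrite (@eq_avg _ _ _ (fun t => \sum_i \sum_b lev_row W^T d t b i * lev_row W^T d t b i)).
    rewrite avg_sum /frob2; apply: eq_bigr => i _; rewrite avg_lev_row // mxE.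
    by apply: eq_bigr => s _; rewrite !mxE expr2.
  by move=> t; rewrite exchange_big.
have frT : frob2 W^T = frob2 W.
  by rewrite /frob2 exchange_big; do 2!apply: eq_bigr => ? _; rewrite mxE.
pose E1 d (f : rows I n m) := `[< exists x,
    \sum_k \sum_b dot (lev_row U d (f k) b) x ^+ 2 < m%:R / 16 * nsq x >].
pose E2 d (f : rows I n m) := eps * m%:R ^+ 2 * frob2 W / 1024 <
    nsq (fun e => \sum_k \sum_b lev_row U d (f k) b e.1 * lev_row W^T d (f k) b e.2).
have cover d f : (`[< ~ near_optimal A B eps (f, d) >])%:R <= (E1 d f)%:R + (E2 d f)%:R :> R.
  have le1 (b : bool) : b%:R <= 1 :> R by rewrite lern1 leq_b1.
  have [h1|h1] := boolP (E1 d f); first by apply: le_trans (le1 _) _; rewrite lerDl.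
  have [h2|h2] := boolP (E2 d f); first by apply: le_trans (le1 _) _; rewrite lerDr.
  rewrite addr0 asboolF //; apply: contrapT.
  rewrite not_notE => bad; apply: bad.
  apply: (near_optimal_of_events m0 (ltW e0) UU AUY UAZ) => [x|].
    by move: h1 => /asboolPn h1; rewrite leNgt; apply/negP => h; apply: h1; exists x.
  by move: h2; rewrite /E2 -leNgt.
have rowsb d : avg (fun f : rows I n m => (`[< ~ near_optimal A B eps (f, d) >])%:R) <=
    (badL _ U d)%:R + (badL _ W^T d)%:R + (D1 + D3).
  have D0 : 0 <= D1 + D3 by rewrite addr_ge0 ?mulr_ge0 ?exprn_ge0 ?expR_ge0 ?invr_ge0.
  have le1 : avg (fun f : rows I n m => (`[< ~ near_optimal A B eps (f, d) >])%:R) <= 1 :> R.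
    apply: le_trans (_ : avg (fun _ : rows I n m => 1) <= _); last exact: avg_const_le.
    by apply: ler_avg => f; rewrite lern1 leq_b1.
  (* For bad signs an indicator on the right equals 1, which bounds any average of an indicator. *)
  have [bU|bU] := boolP (badL _ U d).
    by apply: le_trans le1 _; rewrite -addrA lerDl addr_ge0.
  have [bW|bW] := boolP (badL _ W^T d).
    by apply: le_trans le1 _; rewrite add0r lerDl.
  rewrite !add0r; apply: le_trans (ler_avg (cover d)) _; rewrite avgD addrC.
  have uL t : \sum_b nsq (lev_row U d t b) <= L * q%:R.
    apply: le_trans (goodL _ _ _ t bU) _; rewrite frob2_orthonormal //.
    by rewrite ler_wpM2l ?(ltW L0).
  apply: lerD.
    apply: (cross_term_failure T0 p0 L0 q1 eps01 mL (uw d) (ww d) uL) => t.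
    by rewrite -frT; exact: goodL.
  apply: le_trans (embedding_failure T0 (uu d) m M0 Lq0 _ uL) _.
    by apply: le_trans ML; rewrite ler_wpM2r ?addr_ge0 ?(ltW Lq0) // ler_wpM2l.
  rewrite ler_wpM2r ?expR_ge0 // ler_weXn2l //.
  by rewrite ler1n.
rewrite unif_probE.
have card0 : (0 < #|{: rows I n m * signs I n}|)%N.
  by rewrite card_prod muln_gt0 !card_ffun card_ord card_bool !expn_gt0 P0.
have -> : avg (fun w : rows I n m * signs I n => (`[< near_optimal A B eps w >])%:R) =
    1 - avg (fun w : rows I n m * signs I n => (`[< ~ near_optimal A B eps w >])%:R) :> R.
  rewrite -[X in _ = X - _](avg_const 1 card0); apply/eqP.
  rewrite eq_sym subr_eq -avgD; apply/eqP.
  by apply: eq_avg => w; rewrite asbool_neg; case: asbool; rewrite ?addr0 ?add0r.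
rewrite lerD2l lerN2 avg_pair.
apply: le_trans (ler_avg rowsb) _.
rewrite !avgD !avg_const ?card_ffun ?card_bool ?expn_gt0 //.
have := badP _ U; have := badP _ W^T; lra.
Qed.

End Sketch.

(** * Choice of the parameters *)

Section SampleSize.
Variable R : realType.

Lemma ln_ge1BV (x : R) : 0 < x -> 1 - x^-1 <= ln x.
Proof.
move=> x0; have h1 : -1 < x^-1 - 1 by rewrite ltrBrDl subrr invr_gt0.
have := le_ln1Dx h1; have -> : 1 + (x^-1 - 1) = x^-1 by ring.
by rewrite lnV ?posrE //; lra.
Qed.

(** (10/9)^6 <= 2, and ln (10/9) >= 1 - 9/10. *)
Lemma ln2_ge : 3 / 5 <= ln 2 :> R.
Proof.
apply: le_trans (_ : ln ((10 / 9) ^+ 6) <= _); last first.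
  by rewrite ler_ln ?posrE ?exprn_gt0 //; lra.
have p : 0 < 10 / 9 :> R by lra.
rewrite lnXn //; have := ln_ge1BV p; rewrite invfM invrK -mulr_natr; lra.
Qed.

Lemma nat_above (x : R) : 0 <= x -> exists k : nat, x <= k%:R <= x + 1.
Proof.
move=> x0; exists (Num.truncn x).+1; have /andP[h1 h2] := truncn_itv x0.
by rewrite (ltW h2) -natr1 lerD2r.
Qed.

(** [sketch_failure] with p about 4 ln P and M about 20 L q^2. The first condition on m serves the
    cross term, the second the union over the grid. *)
Lemma sketch_success_probability (N : nat) (I : 'I_N -> nat) (n : 'I_N) (c q m : nat)
    (A : 'M[R]_(cdim_neq I n, q)) (B : 'M[R]_(c, cdim_neq I n)) (eps : R)
    (lP := ln (cdim_neq I n)%:R : R) (d := N.-1) :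
  (1 < cdim_neq I n)%N -> (0 < m)%N -> (0 < q)%N -> 0 < eps <= 1 ->
  400 * 500 * 48 * 24 ^+ d * (lP ^+ d.+1 * q%:R) <= eps * m%:R ->
  16 * 8 * 24 ^+ d * (lP ^+ d * q%:R *
    (q%:R * ln (8 * 8 * 8 * 24 ^+ d * lP ^+ d * q%:R ^+ 2) + 3 * lP)) <= m%:R ->
  1 - expR (- lP) <= unif_prob R (near_optimal A B eps (m := m)).
Proof.
move=> P1 m0 q0 /[dup] eps01 /andP[e0 e1] mK1 mK2; set P := cdim_neq I n in P1 lP mK1 mK2 *.
have P2 : 2 <= P%:R :> R by rewrite ler_nat.
have l2 := ln2_ge.
have lP0 : 3 / 5 <= lP by apply: le_trans l2 _; rewrite /lP ler_ln ?posrE // ltr0n (ltnW P1).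
have q1 : 1 <= q%:R :> R by rewrite ler1n.
(* Then 4 p <= 24 lP, which is the source of the powers of 24. *)
have [p /andP[p4 p5]] : exists p : nat, 4 * lP <= p%:R <= 4 * lP + 1.
  by apply: nat_above; lra.
have p6 : p%:R <= 6 * lP by lra.
have p0 : (0 < p)%N by rewrite -(ltr0n R); lra.
pose L : R := 8 * (4 * p%:R) ^+ d.
have p1 : 1 <= p%:R :> R by rewrite ler1n.
have L1 : 8 <= L.
  by rewrite /L ler_peMr // exprn_ege1 //; lra.
have LP : L <= 8 * 24 ^+ d * lP ^+ d.
  rewrite /L -mulrA -exprMn ler_wpM2l //; apply: lerXn2r; rewrite ?nnegrE; lra.
pose Q : R := q%:R ^+ 2.
have Qq : q%:R <= Q by rewrite /Q expr2 ler_peMr // (le_trans ler01).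
have LQ : 1 <= L * Q by nra.
have [M /andP[M20 M21]] : exists M : nat, 20 * (L * Q) <= M%:R <= 20 * (L * Q) + 1.
  by apply: nat_above; lra.
have M1 : 1 <= M%:R :> R by lra.
have M0 : (0 < M)%N by rewrite -(ltr0n R); lra.
have e8P : P%:R = expR lP :> R by rewrite /lP lnK // posrE; lra.
apply: le_trans (@sketch_failure R N I n c q m p M A B eps _ m0 p0 q0 M0 eps01 _ _).
- rewrite -/d -/P -/L; set D3 := _ * expR _.
  rewrite lerD2l lerN2.
  (* The exponent is p ln 8 >= 4 lP * 3 * (3/5) >= 6 lP. *)
  have h8 : (8 ^+ p)^-1 <= expR (- (6 * lP)) :> R.
    rewrite expRN lef_pV2 ?posrE ?exprn_gt0 ?expR_gt0 //.
    have e8 : 8 = expR (ln 8) :> R by rewrite lnK // posrE.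
    have l8 : ln 8 = 3 * ln 2 :> R.
      rewrite -[3]/(3%:R) mulr_natl -lnXn //; congr ln; ring.
    rewrite e8 -expRM_natl ler_expR l8; nra.
  (* The grid term gets a quarter of 1/P; the three terms with 8^-p below get at most a sixteenth
     each. *)
  have hD3 : D3 <= expR (- lP) / 4.
    have lM : q%:R * ln (2 * M).+1%:R + ln 4 + lP <= m%:R / (16 * (L * q%:R)) :> R.
      have LP0 : 0 < 8 * 24 ^+ d * lP ^+ d by rewrite !mulr_gt0 // exprn_gt0 //; lra.
      have Q1 : 1 <= Q by lra.
      have M2 : (2 * M).+1%:R <= 8 * 8 * 8 * 24 ^+ d * lP ^+ d * q%:R ^+ 2 :> R.
        apply: le_trans (_ : 8 * 8 * (L * Q) <= _).
          by rewrite -natr1 natrM; lra.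
        have -> : 8 * 8 * 8 * 24 ^+ d * lP ^+ d * q%:R ^+ 2 =
            8 * 8 * (8 * 24 ^+ d * lP ^+ d * Q) :> R by rewrite /Q; ring.
        by rewrite ler_wpM2l ?mulr_ge0 // ler_wpM2r //; lra.
      have lM2 : ln (2 * M).+1%:R <= ln (8 * 8 * 8 * 24 ^+ d * lP ^+ d * q%:R ^+ 2) :> R.
        by rewrite ler_ln ?posrE ?ltr0n // (lt_le_trans _ M2) ?ltr0n.
      have lM0 : 0 <= ln (2 * M).+1%:R :> R by rewrite ln_ge0 // ler1n.
      have l4 : ln 4 <= 2 * lP :> R.
        have -> : 4 = 2 ^+ 2 :> R by ring.
        rewrite lnXn // mulr_natl lerMn2r /= ler_ln ?posrE //; lra.
      have l40 : 0 <= ln 4 :> R by rewrite ln_ge0 //; lra.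
      have Lq0 : 0 < L * q%:R by rewrite mulr_gt0 //; lra.
      rewrite ler_pdivlMr; last by apply: mulr_gt0 Lq0.
      apply: le_trans _ mK2; rewrite mulrC.
      have -> : 16 * 8 * 24 ^+ d * (lP ^+ d * q%:R *
          (q%:R * ln (8 * 8 * 8 * 24 ^+ d * lP ^+ d * q%:R ^+ 2) + 3 * lP)) =
        16 * (8 * 24 ^+ d * lP ^+ d * q%:R) *
          (q%:R * ln (8 * 8 * 8 * 24 ^+ d * lP ^+ d * q%:R ^+ 2) + 3 * lP) by ring.
      apply: ler_pM.
      - by rewrite mulr_ge0 // ltW.
      - by rewrite !addr_ge0 ?mulr_ge0 //; lra.
      - by rewrite ler_wpM2l // ler_wpM2r //; lra.
      - have : q%:R * ln (2 * M).+1%:R <=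
            q%:R * ln (8 * 8 * 8 * 24 ^+ d * lP ^+ d * q%:R ^+ 2) by rewrite ler_wpM2l.
        lra.
    have -> : D3 = expR (q%:R * ln (2 * M).+1%:R + - (m%:R / (16 * (L * q%:R)))).
      by rewrite expRD expRM_natl lnK // posrE ltr0n.
    have -> : expR (- lP) / 4 = expR (- lP - ln 4).
      by rewrite expRD [expR (- ln 4)]expRN lnK ?posrE.
    by rewrite ler_expR; lra.
  have E6 : expR (- (6 * lP)) = expR (- lP) ^+ 6 :> R by rewrite -mulrN expRM_natl.
  set x := expR (- lP) in E6 hD3 *.
  have Px : P%:R * x = 1 by rewrite e8P /x -expRD subrr expR0.
  have x0 : 0 < x := expR_gt0 _.
  have x2 : x <= 1 / 2 by nra.
  have x62 : P%:R * x ^+ 6 = x ^+ 5 by rewrite exprS mulrA Px mul1r.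
  have x5 : x ^+ 5 <= x / 16.
    have x4 : x ^+ 4 <= (1 / 2) ^+ 4 by apply: lerXn2r; rewrite ?nnegrE; lra.
    by rewrite exprSr mulrC ler_wpM2l ?(ltW x0) //; apply: le_trans x4 _; lra.
  have x6 : x ^+ 6 <= x / 16.
    apply: le_trans x5; rewrite exprS ler_piMl ?exprn_ge0 ?(ltW x0) //; lra.
  have h9 : P%:R * (8 ^+ p)^-1 <= x / 16.
    by apply: le_trans x5; rewrite -x62 -E6 ler_wpM2l.
  have h10 : (8 ^+ p)^-1 <= x / 16 :> R by apply: le_trans h8 _; rewrite E6.
  by rewrite -mulrA; lra.
- exact: ltnW.
- rewrite -/d -/L -/Q.
  have -> : 16 * q%:R * (L * q%:R + 1 / 4) = 16 * (L * Q) + 4 * q%:R :> R.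
    by rewrite /Q; field.
  apply: le_trans (_ : 20 * (L * Q) <= _); first by nra.
  by apply: le_trans M20 _; rewrite expr2 ler_peMr //; lra.
- rewrite -/d -/L; apply: le_trans mK1.
  have h : p%:R * L <= 6 * lP * (8 * 24 ^+ d * lP ^+ d).
    by apply: ler_pM => //; lra.
  have h2 : p%:R * L * q%:R <= 6 * lP * (8 * 24 ^+ d * lP ^+ d) * q%:R.
    by rewrite ler_wpM2r //; lra.
  apply: le_trans (_ : 400 * 500 * (6 * lP * (8 * 24 ^+ d * lP ^+ d) * q%:R) <= _).
    by apply: ler_wpM2l h2; rewrite mulr_ge0 ?ler0n.
  by rewrite le_eqVlt; apply/orP; left; apply/eqP; rewrite exprS; ring.
Qed.

(** Here [l] and [lam] are the two logarithms in the sample size. One factor lP is kept and the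
    others are traded for K l, one factor q is traded for 4 l, and the logarithm of the grid size
    for K3 lam. The power of l then needed is at most d, within the available 2 d' + 1 = 2 N - 3. *)
Lemma sample_size_sufficient (d' : nat) (K K3 B1 B2 : R) (d := d'.+1) :
  1 <= K -> 0 <= K3 -> 0 <= B1 -> 0 <= B2 ->
  exists C : R, 0 < C /\
    forall lP q eps m l lam lnQ : R, 0 < eps <= 1 -> 0 <= lP <= K * l -> 1 <= l ->
    0 <= q <= 4 * l -> 1 / 6 <= lam -> lnQ <= K3 * lam ->
    C * (eps^-1 * q * l ^+ (2 * d').+1 * lam ^+ 4 * lP) <= m ->
    B1 * (lP ^+ d.+1 * q) <= eps * m /\ B2 * (lP ^+ d * q * (q * lnQ + 3 * lP)) <= m.
Proof.
(* Since 6 lam >= 1, the product s lam^4 = (6 lam)^4 dominates both 1 and lam. *)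
move=> K1 K30 B10 B20; pose s : R := 6 ^+ 4.
have s1 : 1 <= s by rewrite exprn_ege1 //; lra.
have Kd : 1 <= K ^+ d by rewrite exprn_ege1.
have Kd' : 1 <= K ^+ d' by rewrite exprn_ege1.
pose C1 := B1 * (s * K ^+ d).
pose C2 := B2 * (s * (4 * K3 * K ^+ d' + 3 * K ^+ d)).
have sKd : 0 <= s * K ^+ d by rewrite mulr_ge0 //; lra.
have C10 : 0 <= C1 by rewrite mulr_ge0.
have C20 : 0 <= C2.
  have : 0 <= K3 * K ^+ d' by rewrite mulr_ge0 //; lra.
  by move=> h; rewrite !mulr_ge0 //; lra.
have C1C : C1 <= C1 + C2 + 1 by rewrite -addrA lerDl addr_ge0.
have C2C : C2 <= C1 + C2 + 1 by rewrite addrAC lerDr addr_ge0.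
exists (C1 + C2 + 1); split; first by rewrite ltr_wpDl ?addr_ge0.
move=> lP q eps m l lam lnQ /andP[e0 e1] /andP[lP0 lPK] l1 /andP[q0 ql] lam6 lnQK.
pose T := eps^-1 * q * l ^+ (2 * d').+1 * lam ^+ 4 * lP.
rewrite -/T; pose u := q * l ^+ (2 * d').+1 * lam ^+ 4 * lP.
move=> Cm.
have u0 : 0 <= u by rewrite !mulr_ge0 ?exprn_ge0 //; lra.
have uT : u = eps * T.
  have -> : T = eps^-1 * u by rewrite /T /u !mulrA.
  by rewrite mulVKf // gt_eqF.
have T0 : 0 <= T by move: u0; rewrite uT pmulr_rge0.
have uT' : u <= T by rewrite uT ler_piMl.
have lam1 : 1 <= s * lam ^+ 4.
  rewrite /s -exprMn exprn_ege1 //; lra.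
have laml : lam <= s * lam ^+ 4.
  rewrite /s -exprMn; apply: le_trans (_ : 6 * lam <= _); first lra.
  by rewrite ler_eXnr //; lra.
clearbody s.
have lPk k : lP ^+ k <= K ^+ k * l ^+ k.
  by rewrite -exprMn; apply: lerXn2r; rewrite ?nnegrE //; lra.
have l2 : l ^+ d <= l ^+ (2 * d').+1 by rewrite ler_weXn2l // ltnS leq_pmull.
have X1 : lP ^+ d.+1 * q <= s * K ^+ d * u.
  have -> : lP ^+ d.+1 * q = lP * q * lP ^+ d by rewrite exprS; ring.
  have -> : s * K ^+ d * u = lP * q * (K ^+ d * l ^+ (2 * d').+1 * (s * lam ^+ 4)).
    by rewrite /u; ring.
  rewrite ler_wpM2l ?mulr_ge0 //; apply: le_trans (lPk d) _.
  apply: le_trans (_ : K ^+ d * l ^+ (2 * d').+1 <= _).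
    by rewrite ler_wpM2l //; lra.
  by rewrite ler_peMr // mulr_ge0 ?exprn_ge0 //; lra.
have X2 : lP ^+ d * q * (q * lnQ) <= s * (4 * K3 * K ^+ d') * u.
  have -> : s * (4 * K3 * K ^+ d') * u =
      lP * q * (K ^+ d' * (4 * K3 * l ^+ (2 * d').+1 * (s * lam ^+ 4))) by rewrite /u; ring.
  have -> : lP ^+ d * q * (q * lnQ) = lP * q * (lP ^+ d' * (q * lnQ)) by rewrite /d exprS; ring.
  rewrite ler_wpM2l ?mulr_ge0 //.
  apply: le_trans (_ : lP ^+ d' * (4 * l * (K3 * (s * lam ^+ 4))) <= _).
    rewrite ler_wpM2l ?exprn_ge0 //.
    apply: le_trans (_ : q * (K3 * (s * lam ^+ 4)) <= _).
      rewrite ler_wpM2l //; apply: le_trans lnQK _; by rewrite ler_wpM2l.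
    by rewrite ler_wpM2r // mulr_ge0 //; lra.
  apply: le_trans (_ : K ^+ d' * l ^+ d' * (4 * l * (K3 * (s * lam ^+ 4))) <= _).
    apply: ler_wpM2r (lPk d'); apply: mulr_ge0.
      by apply: mulr_ge0; [exact: ler0n|exact: le_trans ler01 l1].
    by apply: mulr_ge0 K30 _; exact: le_trans ler01 lam1.
  have -> : K ^+ d' * l ^+ d' * (4 * l * (K3 * (s * lam ^+ 4))) =
     K ^+ d' * (4 * K3 * l ^+ d * (s * lam ^+ 4)) by rewrite /d (exprS l); ring.
  apply: ler_wpM2l; first exact: le_trans ler01 Kd'.
  apply: ler_wpM2r; first exact: le_trans ler01 lam1.
  by apply: ler_wpM2l l2; exact: mulr_ge0.
split.
  apply: le_trans (_ : C1 * u <= _).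
    by rewrite /C1 -mulrA ler_wpM2l.
  rewrite uT mulrCA ler_wpM2l ?(ltW e0) //; apply: le_trans _ Cm.
  exact: ler_wpM2r.
apply: le_trans (_ : C2 * u <= _).
  rewrite /C2 -[leRHS]mulrA; apply: (ler_wpM2l B20).
  have -> : lP ^+ d * q * (q * lnQ + 3 * lP) = lP ^+ d * q * (q * lnQ) + 3 * (lP ^+ d.+1 * q).
    by rewrite (exprS lP d); ring.
  have -> : s * (4 * K3 * K ^+ d' + 3 * K ^+ d) * u =
    s * (4 * K3 * K ^+ d') * u + 3 * (s * K ^+ d * u) by ring.
  by apply: lerD X2 _; apply: ler_wpM2l X1.
apply: le_trans _ Cm; apply: le_trans (_ : C2 * T <= _); first exact: ler_wpM2l.
exact: ler_wpM2r.
Qed.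

End SampleSize.

(** * Logarithmic estimates for the two sample sizes *)

Section SampleSize.
Variable R : realType.

Lemma ln2_le1 : ln 2 <= 1 :> R.
Proof.
have h : -1 < 1 :> R by lra.
by have := le_ln1Dx h; rewrite (_ : 1 + 1 = 2) //; ring.
Qed.

Lemma ln_sqr (a : R) : 0 < a -> ln (a ^+ 2) = 2 * ln a.
Proof. by move=> a0; rewrite lnXn // mulr_natl. Qed.

Lemma ln4E : ln 4 = 2 * ln 2 :> R.
Proof. by rewrite -ln_sqr ?ltr0n //; congr ln; ring. Qed.

(** The logarithm of the grid size is a constant plus d ln l + 2 ln q, and the constant is absorbed
    through 1 <= 6 lam. *)
Lemma net_log_bound (d : nat) (a K q lP l lam : R) :
  1 <= a -> 1 <= K -> 0 < q -> 0 < lP -> lP <= K * l -> 1 <= l -> 1 / 6 <= lam ->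
  d%:R * ln l + 2 * ln q <= ln 4 + (d%:R + 6) * lam ->
  ln (a * lP ^+ d * q ^+ 2) <= (6 * ln (4 * (a * K ^+ d)) + d%:R + 6) * lam.
Proof.
move=> a1 K1 q0 lP0 lPK l1 lam6 lnb; set k := a * K ^+ d.
have k1 : 1 <= k by rewrite /k mulr_ege1 // exprn_ege1.
have [k0 l0 a0] : [/\ 0 < k, 0 < l & 0 < a] by split; lra.
have ld : 0 < l ^+ d by rewrite exprn_gt0.
have q2 : 0 < q ^+ 2 by rewrite exprn_gt0.
have lPd : 0 < lP ^+ d by rewrite exprn_gt0.
apply: le_trans (_ : ln (k * l ^+ d * q ^+ 2) <= _).
  rewrite ler_ln ?posrE; [|exact: mulr_gt0 (mulr_gt0 _ _) _..].
  apply: ler_wpM2r; first exact: ltW.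
  rewrite /k -[leRHS]mulrA -exprMn; apply: ler_wpM2l; first exact: ltW.
  by apply: lerXn2r lPK; rewrite nnegrE ?mulr_ge0 //; lra.
have -> : ln (k * l ^+ d * q ^+ 2) = ln k + (d%:R * ln l + 2 * ln q).
  rewrite lnM ?posrE //; last exact: mulr_gt0.
  by rewrite lnM ?posrE // lnXn // ln_sqr // -(mulr_natl (ln l)) addrA.
have lk : ln (4 * k) = ln 4 + ln k by rewrite lnM ?posrE // ltr0n.
have lk0 : 0 <= ln (4 * k) by rewrite ln_ge0 //; lra.
have : ln (4 * k) * 1 <= ln (4 * k) * (6 * lam) by apply: ler_wpM2l => //; lra.
move: lnb lk; lra.
Qed.

(** Here l = (q/2) (ln q + ln (1/eps)) + ln (d/eta), with first summand at least ln 2. Thus l < ln 4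
    forces d/eta < 2; otherwise ln l >= 0 and lam is at least (ln q + ln (1/eps)) / 2. *)
Lemma first_sample_size_logs (d : nat) (q eps eta : R)
    (l := ln ((q / eps) `^ (q / 2) * (d%:R / eta)))
    (lam := ln ((q / eps) `^ (2^-1) * l ^+ d)) :
  (0 < d)%N -> 2 <= q -> 0 < eps < 1 -> 0 < eta < 1 ->
  [/\ q * ln 2 <= 2 * l, q * ln eps^-1 <= 2 * l, l < ln 4 -> 1 / 2 <= eta &
      ln 4 <= l -> 1 / 6 <= lam /\
        d%:R * ln l + 2 * ln q <= ln 4 + (d%:R + 6) * lam].
Proof.
move=> d0 q2 /andP[e0 e1] /andP[t0 t1]; have l2 := ln2_ge R.
have d1 : 1 <= d%:R :> R by rewrite ler1n.
have q0 : 0 < q by lra.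
have de1 : 1 <= d%:R / eta by rewrite ler_pdivlMr // mul1r; lra.
have de0 : 0 < d%:R / eta by lra.
have ld0 : 0 <= ln (d%:R / eta) by rewrite ln_ge0.
have qe0 : 0 < q / eps by rewrite divr_gt0.
have lq2 : ln 2 <= ln q by rewrite ler_ln ?posrE //; lra.
have le0 : 0 <= ln eps^-1 by rewrite ln_ge0 // invf_ge1 // ltW.
have lqe : ln (q / eps) = ln q + ln eps^-1 by rewrite lnM ?posrE ?invr_gt0.
have lE : l = q / 2 * (ln q + ln eps^-1) + ln (d%:R / eta).
  by rewrite /l lnM ?posrE ?powR_gt0 // ln_powR lqe.
have hq1 : q * ln 2 <= q * ln q by rewrite ler_pM2l.
have hq2 : 0 <= q * ln eps^-1 by rewrite mulr_ge0 // ltW.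
have l20 : 0 <= ln 2 :> R by lra.
have hq3 : 2 * ln 2 <= q * ln 2 by exact: ler_wpM2r.
clearbody l; split; [lra|lra| |].
  rewrite ln4E => l4.
  have : ln (d%:R / eta) < ln 2 by lra.
  by rewrite ltr_ln ?posrE // ltr_pdivrMr //; lra.
rewrite ln4E => l4; have l1 : 1 <= l by lra.
have l0 : 0 < l by lra.
have lamE : lam = 2^-1 * (ln q + ln eps^-1) + d%:R * ln l.
  by rewrite /lam lnM ?posrE ?powR_gt0 ?exprn_gt0 // ln_powR lqe lnXn // mulr_natl.
have dl0 : 0 <= d%:R * ln l by rewrite mulr_ge0 // ln_ge0.
clearbody lam; split; first lra.
have : 0 <= d%:R * lam by rewrite mulr_ge0 //; lra.
lra.
Qed.

(** With x = ln (q/eps) one has lam = x + ln x, so ln l = ln q + ln x <= lam. As x >= 1/2, also x <=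
    lam + ln 2, which produces the term ln 4 in the bound on 2 ln q. *)
Lemma second_sample_size_logs (d : nat) (q eps : R)
    (l := q * ln (q / eps)) (lam := ln (q / eps * ln (q / eps))) :
  2 <= q -> 0 < eps < 1 ->
  [/\ q * ln 2 <= l, q * ln eps^-1 <= l, 1 / 6 <= lam &
        d%:R * ln l + 2 * ln q <= ln 4 + (d%:R + 6) * lam].
Proof.
move=> q2 /andP[e0 e1]; have l2 := ln2_ge R.
have q0 : 0 < q by lra.
have qe0 : 0 < q / eps by rewrite divr_gt0.
have qe2 : 2 <= q / eps by rewrite ler_pdivlMr //; nra.
have lq2 : ln 2 <= ln q by rewrite ler_ln ?posrE //; lra.
have le0 : 0 <= ln eps^-1 by rewrite ln_ge0 // invf_ge1 // ltW.
have lqe : ln (q / eps) = ln q + ln eps^-1 by rewrite lnM ?posrE ?invr_gt0.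
set x := ln (q / eps) in l lam lqe *.
have x2 : ln 2 <= x by lra.
have x0 : 0 < x by lra.
have lamE : lam = x + ln x by rewrite /lam lnM ?posrE.
have lE : ln l = ln q + ln x by rewrite /l lnM ?posrE.
(* From q/eps >= 2 and x >= 3/5; then lam >= 1 - 5/6 = 1/6. *)
have w : 6 / 5 <= q / eps * x by nra.
have lam6 : 1 / 6 <= lam.
  apply: le_trans (ln_ge1BV _); last by lra.
  have : (q / eps * x)^-1 <= (6 / 5)^-1 by rewrite lef_pV2 ?posrE //; lra.
  lra.
have lx : - ln 2 <= ln x.
  by rewrite -lnV ?posrE // ler_ln ?posrE //; lra.
split => //.
- by rewrite /l ler_pM2l.
- by rewrite /l ler_pM2l //; lra.
- rewrite lE ln4E.
  have : d%:R * (ln q + ln x) <= d%:R * lam by apply: ler_wpM2l => //; lra.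
  clearbody lam; lra.
Qed.

End SampleSize.

(** * Assembly of the two sample size conditions *)

Theorem theorem3p3 (R : realType) (N : nat) (hN : (2 <= N)%N)
    (C0 : R) (hC0 : 0 < C0) :
  exists C c : R, [/\ 0 < C, 0 < c &
    forall (I r : 'I_N -> nat)
      (hI : forall j, (0 < I j)%N) (hr : forall k, (0 < r k)%N)
      (X : tensor R I)
      (G : forall k : 'I_N, tensor3 R (r k) (I k) (r (ordS k)))
      (n : 'I_N) (hn : (2 <= r n * r (ordS n))%N)
      (eps eta : R) (heps : 0 < eps < 1) (heta : 0 < eta < 1)
      (m : nat) (hm : (0 < m)%N),
    let q := (r n * r (ordS n))%N in
    let P : R := (\prod_(j < N | j != n) I j)%N%:R in
    let z : R := (q%:R / eps) `^ (q%:R / 2) * ((N.-1)%:R / eta) in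
    let x : R := eps^-1 * q%:R * ln z ^+ (2 * N - 3) in
    let y : R := ln ((q%:R / eps) `^ (2^-1) * ln z ^+ N.-1) ^+ 4 * ln P in
    let conclusion : Prop :=
      1 - eta - 2 `^ (- (c * ln P)) <=
        unif_prob R (sketch_succeeds X G n eps m) in
    P <= C0 / eps ^+ q ->
    (C * (x * y) <= m%:R -> conclusion) /\
    ((N.-1)%:R / eta <= (q%:R / eps) `^ (q%:R / 2) ->
     C * (eps^-1 * q%:R ^+ (2 * N.-1) * ln (q%:R / eps) ^+ (2 * N - 3) *
          ln (q%:R / eps * ln (q%:R / eps)) ^+ 4 * ln P) <= m%:R ->
     conclusion)].
Proof.
case: N hN => [|[|d']] // _; pose d := d'.+1.
have e3 : (2 * d'.+2 - 3 = (2 * d').+1)%N by rewrite !mulnS.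
(* Chosen so that ln P <= ln C0 + q ln (1/eps) <= K l whenever q ln (1/eps) <= 2 l and l >= 1. *)
pose K : R := `|ln C0| + 2.
pose a : R := 8 * 8 * 8 * 24 ^+ d.
pose K3 : R := 6 * ln (4 * (a * K ^+ d)) + d%:R + 6.
have C0n : 0 <= `|ln C0| := normr_ge0 _.
have K1 : 1 <= K by rewrite /K; lra.
have a1 : 1 <= a by rewrite /a !mulr_ege1 ?exprn_ege1 ?ler1n.
have lK4 : 0 <= ln (4 * (a * K ^+ d)).
  by rewrite ln_ge0 // !mulr_ege1 ?exprn_ege1 ?ler1n.
have K30 : 0 <= K3 by rewrite /K3 !addr_ge0 ?ler0n // mulr_ge0 ?ler0n.
have B10 : 0 <= 400 * 500 * 48 * 24 ^+ d :> R by rewrite !mulr_ge0 ?exprn_ge0 ?ler0n.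
have B20 : 0 <= 16 * 8 * 24 ^+ d :> R by rewrite !mulr_ge0 ?exprn_ge0 ?ler0n.
have [C [Cp Csuff]] := sample_size_sufficient d' K1 K30 B10 B20.
clear B10 B20 lK4.
(* If P <= 16 C0 this gives c ln P <= 1, hence 2^(- c ln P) >= 1/2; moreover c <= 1 makes 2^(- c ln
   P) at least 1/P. *)
pose c : R := (1 + `|ln (16 * C0)|)^-1.
have lC : 0 <= `|ln (16 * C0)| := normr_ge0 _.
have cp : 0 < c by rewrite invr_gt0; lra.
have c1 : c <= 1 by rewrite invf_le1; lra.
have clP lP : 0 <= lP -> lP <= ln (16 * C0) -> c * lP <= 1.
  move=> lP0 lPC; rewrite /c mulrC ler_pdivrMr; last by lra.
  by have := ler_norm (ln (16 * C0)); lra.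
exists C, c; split => // I r hI hr X G n hn eps eta heps heta m hm q P z x y.
move=> conclusion PC0.
set S := sketch_succeeds X G n eps in conclusion *.
have u0 : 0 <= unif_prob R (S m) by rewrite /unif_prob divr_ge0.
have PE : P = (cdim_neq I n)%:R by rewrite cdim_neqE.
have Pn0 : (0 < cdim_neq I n)%N by rewrite cdim_neqE prodn_gt0.
have pow2 b : 2 `^ b = expR (b * ln 2) :> R by rewrite /powR pnatr_eq0.
have [e0 e1] := andP heps; have [t0 t1] := andP heta.
(* For P = 1 the claimed lower bound is - eta, as ln P = 0. *)
have [P1|P1] := leqP (cdim_neq I n) 1.
  have P11 : P = 1.
    by rewrite PE (_ : cdim_neq I n = 1%N) //; apply/eqP; rewrite eqn_leq P1 Pn0.
  have triv : conclusion.
    rewrite /conclusion P11 ln1 mulr0 oppr0 powRr0; apply: le_trans u0.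
    by rewrite addrAC subrr sub0r oppr_le0 ltW.
  split=> [_|_ _]; exact: triv.
pose lP := ln P.
have l2 := ln2_ge R.
have P2 : 2 <= P by rewrite PE ler_nat.
have lP2 : ln 2 <= lP by rewrite ler_ln ?posrE ?(lt_le_trans _ P2) ?ltr0n.
have lP0 : 0 < lP by apply: lt_le_trans lP2; apply: lt_le_trans l2; rewrite divr_gt0 ?ltr0n.
have concl : 1 - expR (- lP) <= unif_prob R (S m) -> conclusion.
  move=> h; rewrite /conclusion; apply: le_trans h.
  rewrite -addrA -opprD lerD2l lerN2 -[leLHS]add0r; apply: lerD; first exact: ltW.
  rewrite pow2 ler_expR mulNr lerN2 -/lP -mulrA.
  apply: le_trans (_ : lP * ln 2 <= _).
    apply: ler_piMl c1; apply: mulr_ge0; first exact: ltW.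
    by apply: le_trans l2; rewrite divr_ge0 ?ler0n.
  by apply: ler_piMr (ln2_le1 R); exact: ltW.
have lPC : lP <= ln C0 + q%:R * ln eps^-1.
  have C0e : 0 < C0 / eps ^+ q by rewrite divr_gt0 ?exprn_gt0.
  have -> : ln C0 + q%:R * ln eps^-1 = ln (C0 / eps ^+ q).
    by rewrite lnM ?posrE ?invr_gt0 ?exprn_gt0 // -exprVn lnXn ?invr_gt0 // mulr_natl.
  by rewrite ler_ln ?posrE // (lt_le_trans _ P2) ?ltr0n.
have q2 : 2 <= q%:R :> R by rewrite ler_nat.
(* Both sample sizes have this shape: l is ln z in part (1) and q ln (q/eps) in part (2). *)
have core (l lam : R) : q%:R * ln 2 <= 2 * l -> q%:R * ln eps^-1 <= 2 * l -> 1 <= l ->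
    1 / 6 <= lam -> d%:R * ln l + 2 * ln q%:R <= ln 4 + (d%:R + 6) * lam ->
    C * (eps^-1 * q%:R * l ^+ (2 * d').+1 * lam ^+ 4 * lP) <= m%:R -> conclusion.
  move=> ql el l1 lam6 lnb Cm; apply: concl.
  have lPK : lP <= K * l.
    apply: le_trans lPC _; rewrite /K mulrDl; apply: lerD el.
    by apply: le_trans (ler_norm _) _; rewrite ler_peMr.
  have q0 : (0 < q)%N by rewrite muln_gt0 !hr.
  have lnQ := net_log_bound a1 K1 _ lP0 lPK l1 lam6 lnb.
  have e01 : 0 < eps <= 1 by rewrite e0 ltW.
  have lPK' : 0 <= lP <= K * l by rewrite lPK ltW.
  have ql' : 0 <= (q%:R : R) <= 4 * l.
    apply/andP; split; first exact: ler0n.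
    have : q%:R * (3 / 5) <= q%:R * ln 2 :> R by rewrite ler_wpM2l.
    by move: ql l1; clear; lra.
  have [] := Csuff _ _ _ _ _ _ _ e01 lPK' l1 ql' lam6 (lnQ _) Cm; first by rewrite ltr0n.
  rewrite /lP PE /q mulnC => h1 h2.
  have q0' : (0 < r (ordS n) * r n)%N by rewrite mulnC.
  exact: (@sketch_success_probability R _ I n (I n) (r (ordS n) * r n)%N m
    (unfold2 (subchain G n)) (unfold_mode n X) eps P1 hm q0' e01 h1 h2).
split=> [hm1|_ hm2].
  have [] := first_sample_size_logs (ltn0Sn d') q2 heps heta.
  set l := ln (_ * (_ / eta)) => ql el eta2 lam.
  have [l4|l4] := leP (ln 4) l.
    have [lam6 lnb] := lam l4.
    have l1 : 1 <= l by move: l4 l2; rewrite ln4E; clear; lra.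
    apply: (core l _ ql el l1 lam6 lnb).
    by move: hm1; rewrite /x /y e3 -/lP; congr (C * _ <= _); rewrite -!mulrA.
  (* The remaining case l < ln 4: since q ln (1/eps) <= 2 l < ln 16, P is at most 16 C0. Then eta
     and 2^(- c ln P) are both at least 1/2, and the claimed lower bound is not positive. *)
  have lP16 : lP <= ln (16 * C0).
    have -> : ln (16 * C0) = 2 * ln 4 + ln C0.
      rewrite lnM ?posrE ?ltr0n // -ln_sqr ?ltr0n //; congr (ln _ + _); ring.
    by move: lPC el l4; clear; lra.
  have half : 1 / 2 <= 2 `^ (- (c * lP)) :> R.
    have -> : 1 / 2 = expR (- ln 2) :> R by rewrite expRN lnK ?posrE ?ltr0n // mul1r.
    rewrite pow2 ler_expR mulNr lerN2; apply: ler_piMl; last exact: clP (ltW lP0) lP16.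
    by move: l2; clear; lra.
  apply: le_trans u0; rewrite -/lP.
  by move: half (eta2 l4); clear; lra.
have [] := second_sample_size_logs d q2 heps.
set l := q%:R * ln (q%:R / eps); set lam := ln (_ / _ * _) => ql el lam6 lnb.
have l1 : 1 <= l.
  have : 2 * (3 / 5) <= q%:R * ln 2 :> R.
    by apply: ler_pM q2 l2; rewrite ?divr_ge0 ?ler0n.
  by move: ql; clear; lra.
have dbl (b : R) : b <= l -> b <= 2 * l by move: l1; clear; lra.
apply: (core l lam (dbl _ ql) (dbl _ el) l1 lam6 lnb).
move: hm2; rewrite e3 -/lP; congr (C * _ <= _).
(* The 2 N - 3 factors q inside the power of l and the one outside make up q^(2 (N - 1)). *)
rewrite /l exprMn (_ : (2 * d'.+2.-1 = (2 * d').+2)%N) ?mulnS //.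
by rewrite (exprS q%:R (2 * d').+1) !mulrA.
Qed.
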